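(* Let $X$ be a geometric Brownian motion, $dX_t=\mu X_t\,dt+\sigma X_t\,dW_t$, with $\mu\in\mathbb R$, $\sigma>0$ constants and $W$ a standard Brownian motion, with state space $\mathbb X=(0,\infty)$; let $f(x)=x$ on $\mathbb X$ and $\delta(t)=\frac1{1+\beta t}$ with $\beta>0$. Let $\nu:=\frac{\mu}{\sigma^2}-\frac12$ and suppose $\nu\le-1/2$. Then $(0,\infty)$ is the only closed equilibrium. Hence $R^*:=\bigcap_{R\in\mathcal E,\ R\text{ closed}}R$ equals $(0,\infty)$, and it is the unique closed optimal equilibrium.
   Context: $\mathcal B(\mathbb X)$ is the collection of Borel subsets of $\mathbb X$; $\mathbb P^x,\mathbb E^x$ denote probability and expectation given $X_0=x$, and $X^x$ denotes $X$ started at $x\in\mathbb X$. For $x\in\mathbb X$, $R\in\mathcal B(\mathbb X)$: $\rho(x,R):=\inf\{t>0: X^x_t\in R\}$ ($\inf\emptyset=\infty$) and $J(x,R):=\mathbb E^x[\delta(\rho(x,R))f(X_{\rho(x,R)})]$, where on $\{\rho(x,R)=\infty\}$ the integrand is taken to be $\limsup_{t\to\infty}\delta(t)f(X^x_t)$. Put $S_R:=\{x: f(x)>J(x,R)\}$, $I_R:=\{x: f(x)=J(x,R)\}$, and $\Theta(R):=S_R\cup(I_R\cap R)$. $R\in\mathcal B(\mathbb X)$ is an equilibrium if $\Theta(R)=R$; $\mathcal E$ is the set of all equilibria. $V(x,R):=\max\{f(x),J(x,R)\}$. $\hat R\in\mathcal E$ is an optimal equilibrium if $V(x,\hat R)\ge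 V(x,R)$ for all $x\in\mathbb X$ and all $R\in\mathcal E$. ''Closed'' means closed relative to $\mathbb X$. *)

(* Defs.v *)
From HB Require Import structures.
From mathcomp Require Export all_boot all_order all_algebra.
From mathcomp Require Export all_classical all_reals all_analysis.
Export Order.TTheory GRing.Theory Num.Theory.
Export numFieldNormedType.Exports.

Set Implicit Arguments.
Unset Strict Implicit.
Unset Printing Implicit Defensive.

Local Open Scope classical_set_scope.
Local Open Scope ring_scope.

(* A continuous-time process is a map Y : R -> T -> R; only the times t >= 0
   are meaningful, and no definition below looks at negative times. *)

Section StochasticCalculus.
Context {R : realType} {d : measure_display} {T : measurableType d}.
Implicit Types (P : probability T R) (F : R -> set (set T)).
Implicit Types (W H I X : R -> T -> R).

Record filtration F : Prop := Filtration {
  filtration_sigma : forall t : R, 0 <= t -> sigma_algebra setT (F t);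
  filtration_measurable : forall t : R, 0 <= t -> F t `<=` measurable;
  filtration_mono : forall s t : R, 0 <= s -> s <= t -> F s `<=` F t }.

Definition measurable_wrt (G : set (set T)) (Z : T -> R) : Prop :=
  forall B : set R, measurable B -> G (Z @^-1` B).

Definition adapted F X : Prop :=
  forall t : R, 0 <= t -> measurable_wrt (F t) (X t).

Definition continuous_paths X : Prop :=
  forall w, {within `[0, +oo[, continuous (fun t : R => X t w)}.

(* The second argument of [normal_prob] is the standard deviation. *)
Record brownian_motion P F W : Prop := BrownianMotion {
  brownian_filtration : filtration F;
  brownian_adapted : adapted F W;
  brownian_continuous : continuous_paths W;
  brownian_start : {ae P, forall w, W 0 w = 0};
  brownian_gaussian : forall s t : R, 0 <= s -> s < t ->
    forall B : set R, measurable B ->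
      P [set w | B (W t w - W s w)] = normal_prob 0 (Num.sqrt (t - s)) B;
  brownian_indep : forall s t : R, 0 <= s -> s < t ->
    forall (A : set T) (B : set R), F s A -> measurable B ->
      P (A `&` [set w | B (W t w - W s w)]) =
      (P A * P [set w | B (W t w - W s w)%R])%E }.

(* The bounded simple process \sum_(i < simple_size) xi_i 1_(t_i, t_(i+1)],
   with xi_i being F_(t_i)-measurable. *)
Record simple_process F := SimpleProcess {
  simple_size : nat;
  simple_time : nat -> R;
  simple_coef : nat -> T -> R;
  simple_time_ge0 : forall i, 0 <= simple_time i;
  simple_time_mono : forall i, simple_time i <= simple_time i.+1;
  simple_coef_measurable :
    forall i, measurable_wrt (F (simple_time i)) (simple_coef i);
  simple_coef_bounded : exists M : R, forall i w, `|simple_coef i w| <= M }.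

Definition simple_val F (H : simple_process F) : R -> T -> R := fun s w =>
  \sum_(i < simple_size H) simple_coef H i w *
    \1_(`]simple_time H i, simple_time H i.+1]) s.

Definition simple_integral F (H : simple_process F) W : R -> T -> R :=
  fun t w => \sum_(i < simple_size H) simple_coef H i w *
    (W (Num.min (simple_time H i.+1) t) w - W (Num.min (simple_time H i) t) w).

Definition cvg_prob0 P (Y : nat -> T -> \bar R) : Prop :=
  forall e : R, 0 < e ->
    (fun n => P [set w | (e%:E < Y n w)%E]) @ \oo --> 0%E.

(* I is (a continuous version of) the Ito integral t |-> \int_0^t H_s dW_s:
   simple processes converge to H in L^2([0, U]) in probability, and their
   elementary integrals converge to I uniformly on [0, U] in probability,
   for every horizon U. *)
Definition ito_integral P F W H I : Prop :=
  [/\ adapted F I, continuous_paths I &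
    exists Hn : nat -> simple_process F, forall U : R, 0 <= U ->
      cvg_prob0 P (fun n w =>
        \int[lebesgue_measure]_(s in `[0%R, U])
          ((simple_val (Hn n) s w - H s w) ^+ 2)%:E)%E /\
      cvg_prob0 P (fun n w =>
        ereal_sup [set (`|simple_integral (Hn n) W t w - I t w|)%:E
                  | t in `[0, U]])].

(* X is a strong solution of dX_t = b(X_t) dt + s(X_t) dW_t, X_0 = x. *)
Definition sde_solution P F W (b s : R -> R) (x : R) X : Prop :=
  [/\ adapted F X, continuous_paths X, forall w, X 0 w = x &
    exists2 I, ito_integral P F W (fun t w => s (X t w)) I &
      {ae P, forall w, forall t : R, 0 <= t ->
        X t w = x + (\int[lebesgue_measure]_(r in `[0, t]) b (X r w)) + I t w}].

(* X x is the process started at x; the state space is (0, +oo). *)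
Definition geometric_brownian_motion P F W (mu sigma : R)
    (X : R -> R -> T -> R) : Prop :=
  forall x, 0 < x ->
    sde_solution P F W (fun y => mu * y) (fun y => sigma * y) x (X x) /\
    (forall t w, 0 <= t -> 0 < X x t w).

End StochasticCalculus.

Section Equilibria.
Context {R : realType} {d : measure_display} {T : measurableType d}.
Variables (P : probability T R) (D : set R) (X : R -> R -> T -> R).
Variables (f delta : R -> R).
Implicit Types (x : R) (A : set R).
Local Open Scope ereal_scope.

Definition hitting_time x A (w : T) : \bar R :=
  ereal_inf [set t%:E | t in [set t : R | (0 < t)%R /\ A (X x t w)]].

Definition stopped_payoff x A (w : T) : \bar R :=
  if hitting_time x A w is t%:E then (delta t * f (X x t w))%:E
  else limf_esup (fun t : R => (delta t * f (X x t w))%:E) (pinfty_nbhs R).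

Definition J x A : \bar R := \int[P]_w stopped_payoff x A w.

Definition stop_region A : set R := [set x | D x /\ J x A < (f x)%:E].

Definition indiff_region A : set R := [set x | D x /\ (f x)%:E = J x A].

Definition Theta A : set R := stop_region A `|` (indiff_region A `&` A).

Definition equilibrium A : Prop :=
  [/\ measurable A, A `<=` D & Theta A = A].

Definition V x A : \bar R := maxe (f x)%:E (J x A).

Definition optimal_equilibrium A : Prop :=
  equilibrium A /\
  forall x B, D x -> equilibrium B -> V x B <= V x A.

Definition closed_rel A : Prop := exists2 C : set R, closed C & A = D `&` C.

Definition closed_equilibrium A : Prop := equilibrium A /\ closed_rel A.

Definition Rstar : set R :=
  \bigcap_(A in [set A | closed_equilibrium A]) A.

End Equilibria.

(* Main.v *)
(* Since mu <= 0, the geometric Brownian motion X is a positive supermartingale.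
   This is read off the definition of the Ito integral: the approximating
   simple processes are truncated at the first time their quadratic variation
   exceeds a level K, which makes their stochastic integrals centered and
   bounded in L^2; positivity of X gives an asymptotic lower bound for them, so
   that their expectations survive the passage to the limit.
   By optional stopping along grids and Fatou's lemma, the value of X at the
   first hitting time of any set B not containing the starting point x has
   expectation at most x, and the maximal inequality makes the discounted payoff
   vanish when B is never hit, so J(x, B) <= x. When B is closed the hitting time
   is positive and the discounting makes the inequality strict: x belongs to the
   stopping region of B, and so a closed equilibrium contains every x > 0.
   For x in an equilibrium B, the fixed-point equation Theta(B) = B itself gives
   J(x, B) <= x, hence no equilibrium improves on f. *)
From HB Require Import structures.
Require Import Defs.
From mathcomp Require Import measurable_realfun ring lra.

Set Implicit Arguments.
Unset Strict Implicit.
Unset Printing Implicit Defensive.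

Local Open Scope classical_set_scope.
Local Open Scope ring_scope.

(** * Moments of centered Gaussian increments *)

(** The Ito integral is given only as a limit in probability, uniform on compact time intervals, so
    simple integrals approximating it carry no common moment bound and neither a martingale property
    nor an isometry passes to the limit. An L^2 bound depending on the level K alone is the
    substitute; any constant serves in it, hence 4 * sqrt 2, the outcome of a crude domination
    between Gaussian densities. The price of truncation is that the integral may stop before t, at a
    path-dependent time: uniform convergence and X > 0 at that time still give a lower bound, while
    the upper bound on X_t is used only where the truncation is inactive. A second obstacle is that
    an equilibrium is a mere Borel set, with no measurability known for the hitting time or the
    payoff. Hitting events are adapted all the same, because paths are continuous, real-valued and
    start at a fixed point: the intermediate value theorem reduces any set to half-lines. The value
    at the hitting time is replaced by the liminf of grid values, and payoffs are only ever compared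
    with majorants. *)

Section normal_moments.
Context {R : realType}.
Implicit Types (s y : R).
Local Notation leb := (@lebesgue_measure R).
Local Notation nprob s := (normal_prob 0 s : set (measurableTypeR R) -> \bar R).

Lemma ge0_integral_normal_prob s (f : R -> \bar R) :
  measurable_fun [set: R] f -> (forall y, 0 <= f y)%E ->
  (\int[nprob s]_y f y =
   \int[leb]_y (f y * (normal_pdf 0 s y)%:E))%E.
Proof.
move=> mf f0.
have dom : normal_prob 0 s `<< leb := normal_prob_dominates 0 s.
rewrite -(Radon_Nikodym_SigmaFinite.change_of_variables dom)//.
have fint := Radon_Nikodym_SigmaFinite.f_integrable dom.
apply: ge0_ae_eq_integral => //.
- by apply: emeasurable_funM => //; exact: measurable_int fint.
- apply: emeasurable_funM => //; apply/measurable_EFinP.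
  exact: measurable_normal_pdf.
- by move=> y _; rewrite mule_ge0// Radon_Nikodym_SigmaFinite.f_ge0.
- by move=> y _; rewrite mule_ge0// lee_fin normal_pdf_ge0.
(* The Radon-Nikodym derivative agrees with [normal_pdf] almost everywhere because both integrate to
   [normal_prob] over every measurable set. *)
- apply: ae_eqe_mul2l; apply: integral_ae_eq => //.
  + by apply/measurable_EFinP; exact: measurable_normal_pdf.
  + by move=> E _ mE; rewrite -Radon_Nikodym_SigmaFinite.f_integral.
Qed.

Lemma ge0_integral_lebesgueN (f : R -> \bar R) :
  measurable_fun [set: R] f -> (forall y, 0 <= f y)%E ->
  (\int[leb]_y f (- y)%R = \int[leb]_y f y)%E.
Proof.
move=> mf f0.
rewrite [RHS](eq_measure_integral
  (pushforward leb (-%R : _ -> measurableTypeR R))); last first.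
  by move=> A mA _; exact/esym/lebesgue_measureN.
by rewrite ge0_integral_pushforward//=; exact: oppr_measurable.
Qed.

Lemma ge0_integral_normal_probN s (f : R -> \bar R) : s != 0 ->
  measurable_fun [set: R] f -> (forall y, 0 <= f y)%E ->
  (\int[nprob s]_y f (- y)%R = \int[nprob s]_y f y)%E.
Proof.
move=> s0 mf f0.
have pdfN y : normal_pdf 0 s (- y) = normal_pdf 0 s y :> R.
  by rewrite !normal_pdfE// /normal_fun !subr0 sqrrN.
rewrite !ge0_integral_normal_prob//; last exact: measurableT_comp.
rewrite -[RHS]ge0_integral_lebesgueN//.
- by apply: eq_integral => y _; rewrite pdfN.
- apply: emeasurable_funM => //; apply/measurable_EFinP.
  exact: measurable_normal_pdf.
- by move=> y; rewrite mule_ge0// lee_fin normal_pdf_ge0.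
Qed.

(** With u = y^2 / (4 a) this is u * exp(- 2 u) <= exp(- u), that is u <= exp u. Half of the
    Gaussian decay absorbs y^2 and leaves the shape of a Gaussian of twice the variance. *)
Lemma sqr_mul_expR_le (a y : R) : 0 < a ->
  y ^+ 2 * expR (- (y ^+ 2 / (2 * a))) <= 4 * a * expR (- (y ^+ 2 / (4 * a))).
Proof.
move=> a0; set u := y ^+ 2 / (4 * a).
have -> : y ^+ 2 = 4 * a * u by rewrite /u; field; rewrite gt_eqF.
have -> : 4 * a * u / (2 * a) = u + u by field; rewrite gt_eqF.
rewrite opprD expRD -mulrA ler_pM2l ?mulr_gt0// mulrA.
rewrite -[leRHS]mul1r ler_pM2r ?expR_gt0//.
rewrite expRN ler_pdivrMr ?expR_gt0// mul1r.
by rewrite (le_trans _ (expR_ge1Dx _))// lerDr.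
Qed.

(** The integrand is dominated by a multiple of the density with standard deviation s * sqrt 2: the
    factor 4 s^2 comes from [sqr_mul_expR_le] at a = s^2, and sqrt 2 is the ratio of the two
    normalising constants. *)
Lemma normal_second_moment_le s : 0 < s ->
  (\int[nprob s]_y (y ^+ 2)%:E <= (4 * s ^+ 2 * Num.sqrt 2)%:E)%E.
Proof.
move=> s0.
have s2 : 0 < s * Num.sqrt 2 by rewrite mulr_gt0.
rewrite ge0_integral_normal_prob//; last 2 first.
- by apply/measurable_EFinP; exact: exprn_measurable.
- by move=> y; rewrite lee_fin sqr_ge0.
have mpdf r : measurable_fun [set: R] (fun y : R => (normal_pdf 0 r y)%:E).
  by apply/measurable_EFinP; exact: measurable_normal_pdf.
apply: (@le_trans _ _ (\int[leb]_y ((4 * s ^+ 2 * Num.sqrt 2)%:E *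
    (normal_pdf 0 (s * Num.sqrt 2) y)%:E))%E); last first.
  rewrite ge0_integralZl//.
  - by rewrite integral_normal_pdf mule1.
  - exact: mpdf.
  - by move=> y _; rewrite lee_fin normal_pdf_ge0.
  - rewrite lee_fin; apply: mulr_ge0; last exact: sqrtr_ge0.
    by apply: mulr_ge0; rewrite ?sqr_ge0.
apply: ge0_le_integral => //.
- by move=> y _; rewrite -EFinM lee_fin mulr_ge0 ?sqr_ge0 ?normal_pdf_ge0.
- apply: emeasurable_funM => //.
  by apply/measurable_EFinP; exact: exprn_measurable.
  exact: mpdf.
- by apply: emeasurable_funM => //; exact: mpdf.
move=> y _; rewrite -!EFinM lee_fin !normal_pdfE ?gt_eqF//.
rewrite /normal_fun subr0 /normal_peak exprMn sqr_sqrtr//.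
rewrite -[s ^+ 2 * 2 * pi *+ 2]mulr_natr.
rewrite (_ : s ^+ 2 * 2 * pi * 2%:R = (s ^+ 2 * pi *+ 2) * 2); last by ring.
rewrite sqrtrM ?mulrn_wge0 ?mulr_ge0 ?sqr_ge0 ?pi_ge0//.
set c := Num.sqrt (s ^+ 2 * pi *+ 2).
have c0 : 0 < c.
  by rewrite sqrtr_gt0 mulrn_wgt0// mulr_gt0 ?pi_gt0// exprn_gt0.
have r0 : 0 < Num.sqrt 2 :> R by rewrite sqrtr_gt0.
move: (Num.sqrt 2) r0 => r r0.
have := sqr_mul_expR_le y (exprn_gt0 2 s0).
rewrite -!mulNr (_ : s ^+ 2 *+ 2 = 2 * s ^+ 2); last by ring.
rewrite (_ : s ^+ 2 * 2 *+ 2 = 4 * s ^+ 2); last by ring.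
move: (expR _) (expR _) => e1 e2 e12.
have -> : 4 * s ^+ 2 * r * ((c * r)^-1 * e1) = c^-1 * (4 * s ^+ 2 * e1).
  by field; rewrite !gt_eqF.
rewrite mulrCA ler_pM2l ?invr_gt0//.
all: exact: ltW.
Qed.

End normal_moments.

(** * Independence and product laws *)

Section independence.
Context {R : realType} {d : measure_display} {T : measurableType d}.
Variables (P : probability T R) (Z D : T -> R).
Variable nu : probability (measurableTypeR R) R.
Hypotheses (mZ : measurable_fun [set: T] Z) (mD : measurable_fun [set: T] D).
Hypothesis ZD_indep : forall A B : set R, measurable A -> measurable B ->
  P (Z @^-1` A `&` D @^-1` B) = (P (Z @^-1` A) * nu B)%E.

(** The law of (Z, D) agrees with the product of the law of Z and [nu] on rectangles, hence
    everywhere; Tonelli then integrates D out first. *)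
Lemma ge0_integral_indep (h : R * R -> \bar R) :
  measurable_fun [set: R * R] h -> (forall z, 0 <= h z)%E ->
  (\int[P]_w h (Z w, D w) = \int[P]_w \int[nu]_y h (Z w, y))%E.
Proof.
move=> mh h0.
have mZ_ : measurable_fun [set: T] (Z : T -> measurableTypeR R) by exact: mZ.
pose Z' : {mfun T >-> measurableTypeR R} :=
  HB.pack Z (isMeasurableFun.Build _ _ _ _ _ mZ_).
have mZD : measurable_fun [set: T]
    (fun w => (Z w, D w) : measurableTypeR R * measurableTypeR R)%type.
  exact/measurable_fun_pair.
pose ZD : {mfun T >-> (measurableTypeR R * measurableTypeR R)%type} :=
  HB.pack (fun w => (Z w, D w)) (isMeasurableFun.Build _ _ _ _ _ mZD).
have -> : (\int[P]_w h (Z w, D w) = \int[distribution P ZD]_z h z)%E.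
  by rewrite ge0_integral_distribution.
have lawE (C : set (measurableTypeR R * measurableTypeR R)) : measurable C ->
    (distribution P Z' \x nu)%E C = distribution P ZD C.
  by apply: product_measure_unique => A B mA mB; exact: ZD_indep.
rewrite -(eq_measure_integral _ (fun C mC _ => lawE C mC)) fubini_tonelli1//=.
by rewrite ge0_integral_distribution//=;
  [exact: measurable_fun_fubini_tonelli_F|move=> y; exact: integral_ge0].
Qed.

End independence.

Section centered_gaussian_increment.
Context {R : realType} {d : measure_display} {T : measurableType d}.
Variables (P : probability T R) (Z D : T -> R) (s : R).
Hypothesis s0 : 0 < s.
Hypotheses (mZ : measurable_fun [set: T] Z) (mD : measurable_fun [set: T] D).
Hypothesis ZD_indep : forall A B : set R, measurable A -> measurable B ->
  P (Z @^-1` A `&` D @^-1` B) = (P (Z @^-1` A) * normal_prob 0 s B)%E.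

Local Notation nu := (normal_prob 0 s : set (measurableTypeR R) -> \bar R).

Lemma gaussian_sqr_mul_le :
  (\int[P]_w ((Z w * D w) ^+ 2)%:E <=
   (4 * s ^+ 2 * Num.sqrt 2)%:E * \int[P]_w ((Z w) ^+ 2)%:E)%E.
Proof.
rewrite (@ge0_integral_indep _ _ _ P Z D (normal_prob 0 s) mZ mD ZD_indep
  (fun z => ((z.1 * z.2) ^+ 2)%:E)); last 2 first.
- apply/measurable_EFinP; apply: measurable_funX; exact: measurable_funM.
- by move=> z; rewrite lee_fin sqr_ge0.
have c0 : (0 <= (4 * s ^+ 2 * Num.sqrt 2 : R)%:E)%E.
  by rewrite lee_fin mulr_ge0 ?sqrtr_ge0// mulr_ge0// sqr_ge0.
have mZ2 : measurable_fun [set: T] (fun w => (Z w ^+ 2)%:E).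
  by apply/measurable_EFinP; exact: measurable_funX.
rewrite -ge0_integralZl//; last by move=> w _; rewrite lee_fin sqr_ge0.
have intE w : (\int[nu]_y ((Z w * y) ^+ 2)%:E =
    (Z w ^+ 2)%:E * \int[nu]_y (y ^+ 2)%:E)%E.
  rewrite -ge0_integralZl//.
  - by apply: eq_integral => y _; rewrite exprMn EFinM.
  - by apply/measurable_EFinP; exact: exprn_measurable.
  - by move=> y _; rewrite lee_fin sqr_ge0.
  - by rewrite lee_fin sqr_ge0.
rewrite (_ : (\int[P]_w _ = \int[P]_w ((Z w ^+ 2)%:E * \int[nu]_y (y ^+ 2)%:E))%E);
  last by apply: eq_integral => w _; exact: intE.
apply: ge0_le_integral => //.
- by move=> w _; rewrite mule_ge0 ?integral_ge0// ?lee_fin ?sqr_ge0// => y _;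
    rewrite lee_fin sqr_ge0.
- exact: emeasurable_funM.
- exact: emeasurable_funM.
- move=> w _; rewrite muleC lee_wpmul2r ?lee_fin ?sqr_ge0//.
  exact: normal_second_moment_le.
Qed.

(* (Z, D) and (Z, -D) have the same law. *)
Lemma gaussian_mul_mean0 :
  P.-integrable [set: T] (fun w => (Z w * D w)%:E) ->
  (\int[P]_w (Z w * D w)%:E = 0)%E.
Proof.
move=> /integrable_pos_fin_num fin; rewrite integralE.
pose g (z : R * R) := maxe (z.1 * z.2)%:E 0%E : \bar R.
have g0 z : (0 <= g z)%E by rewrite le_max lexx orbT.
have mg : measurable_fun [set: R * R] g.
  apply: measurable_maxe => //; apply/measurable_EFinP.
  exact: measurable_funM.
have mgN : measurable_fun [set: R * R] (fun z => g (z.1, - z.2)).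
  apply: (measurableT_comp mg); apply: measurable_fun_pair => //.
  exact: measurableT_comp.
suff: (\int[P]_w ((fun w => (Z w * D w)%:E)^\- w) =
    \int[P]_w ((fun w => (Z w * D w)%:E)^\+ w))%E.
  by move=> ->; apply: subee; exact: fin.
transitivity (\int[P]_w g (Z w, (- D w)%R))%E.
  by apply: eq_integral => w _; rewrite funenegE /g /= mulrN.
transitivity (\int[P]_w g (Z w, D w))%E; last first.
  by apply: eq_integral => w _; rewrite funeposE.
rewrite (ge0_integral_indep mZ mD ZD_indep mg g0).
rewrite (ge0_integral_indep mZ mD ZD_indep mgN (fun=> g0 _)).
apply: eq_integral => w _ /=.
rewrite (ge0_integral_normal_probN (f := fun y => g (Z w, y))) ?gt_eqF//.
by apply: (measurableT_comp mg); exact: measurable_pair1.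
Qed.

End centered_gaussian_increment.

(** * Stochastic integrals of simple processes *)

Section measurable_wrt.
Context {R : realType} {d : measure_display} {T : measurableType d}.
Variable G : set (set T).
Hypothesis sG : sigma_algebra setT G.
Implicit Types (Y Z : T -> R).

(** Viewing the sub-sigma-algebra as a measurable type gives access to the usual closure properties
    of measurable functions. *)
Lemma measurable_wrtP Z : measurable_wrt G Z <->
  measurable_fun [set: g_sigma_algebraType G] (Z : g_sigma_algebraType G -> R).
Proof.
split=> [mZ _ B mB|mZ B mB].
  by rewrite setTI /measurable/= sigma_algebra_id//; exact: mZ.
by have := mZ measurableT _ mB; rewrite setTI /measurable/= sigma_algebra_id.
Qed.

Lemma measurable_wrtD Y Z : measurable_wrt G Y -> measurable_wrt G Z ->
  measurable_wrt G (fun w => Y w + Z w).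
Proof.
by move=> /measurable_wrtP mY /measurable_wrtP mZ;
  apply/measurable_wrtP; exact: measurable_funD.
Qed.

Lemma measurable_wrtM Y Z : measurable_wrt G Y -> measurable_wrt G Z ->
  measurable_wrt G (fun w => Y w * Z w).
Proof.
by move=> /measurable_wrtP mY /measurable_wrtP mZ;
  apply/measurable_wrtP; exact: measurable_funM.
Qed.

Lemma measurable_wrtB Y Z : measurable_wrt G Y -> measurable_wrt G Z ->
  measurable_wrt G (fun w => Y w - Z w).
Proof.
by move=> /measurable_wrtP mY /measurable_wrtP mZ;
  apply/measurable_wrtP; exact: measurable_funB.
Qed.

Lemma measurable_wrt_cst (k : R) : measurable_wrt G (fun=> k).
Proof. exact/measurable_wrtP. Qed.

Lemma measurable_wrt_sum n (Y : nat -> T -> R) :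
  (forall i, (i < n)%N -> measurable_wrt G (Y i)) ->
  measurable_wrt G (fun w => \sum_(i < n) Y i w).
Proof.
elim: n => [|n ih] mY.
  by under eq_fun do rewrite big_ord0; exact: measurable_wrt_cst.
under eq_fun do rewrite big_ord_recr/=.
apply: measurable_wrtD; last exact: mY.
by apply: ih => i ilt; apply: mY; exact: ltnW.
Qed.

Lemma measurable_wrt_indic (A : set T) : G A -> measurable_wrt G (\1_A : T -> R).
Proof.
move=> GA; apply/measurable_wrtP; apply: measurable_indic.
by rewrite /measurable/= sigma_algebra_id.
Qed.

End measurable_wrt.

Section stochastic_sums.
Context {R : realType} {d : measure_display} {T : measurableType d}.
Variables (P : probability T R) (F : R -> set (set T)) (W : R -> T -> R).
Hypothesis BM : brownian_motion P F W.

Lemma measurable_of_wrt (t : R) (Z : T -> R) : 0 <= t ->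
  measurable_wrt (F t) Z -> measurable_fun [set: T] Z.
Proof.
move=> t0 mZ _ B mB; rewrite setTI.
exact/(filtration_measurable (brownian_filtration BM) t0)/mZ.
Qed.

Lemma measurable_wrt_mono (s t : R) (Z : T -> R) : 0 <= s -> s <= t ->
  measurable_wrt (F s) Z -> measurable_wrt (F t) Z.
Proof.
move=> s0 st mZ B /mZ.
exact: (filtration_mono (brownian_filtration BM) s0 st).
Qed.

Lemma brownian_measurable (t : R) : 0 <= t -> measurable_fun [set: T] (W t).
Proof. by move=> t0; apply: measurable_of_wrt (brownian_adapted BM t0). Qed.

(** Takes the place of the constant 1 in the Ito isometry, which here becomes an inequality. *)
Let sq2 : R := 4 * Num.sqrt 2.

Lemma brownian_increment_indep (u v : R) (Z : T -> R) : 0 <= u -> u < v ->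
  measurable_wrt (F u) Z -> forall A B : set R, measurable A -> measurable B ->
  P (Z @^-1` A `&` (fun w => W v w - W u w) @^-1` B) =
  (P (Z @^-1` A) * normal_prob 0 (Num.sqrt (v - u)) B)%E.
Proof.
move=> u0 uv mZ A B mA mB; rewrite (brownian_indep BM u0 uv (mZ _ mA) mB).
by congr (_ * _)%E; exact: (brownian_gaussian BM u0 uv mB).
Qed.

Lemma increment_measurable (u v : R) : 0 <= u -> u <= v ->
  measurable_fun [set: T] (fun w => W v w - W u w).
Proof.
move=> u0 uv; apply: measurable_funB; apply: brownian_measurable => //.
exact: le_trans uv.
Qed.

(** The case u = v is included because clamped grids repeat points, whereas the Gaussian estimate
    asks for a positive standard deviation. *)
Lemma increment_sqr_le (u v : R) (Z : T -> R) : 0 <= u -> u <= v ->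
  measurable_wrt (F u) Z ->
  (\int[P]_w ((Z w * (W v w - W u w)) ^+ 2)%:E <=
   (sq2 * (v - u))%:E * \int[P]_w ((Z w) ^+ 2)%:E)%E.
Proof.
move=> u0; rewrite le_eqVlt => /predU1P[<-{v}|uv] mZ.
  rewrite subrr mulr0 mul0e integral0_eq// => w _.
  by rewrite subrr mulr0 expr0n.
have s0 : 0 < Num.sqrt (v - u) by rewrite sqrtr_gt0 subr_gt0.
have := gaussian_sqr_mul_le s0 (measurable_of_wrt u0 mZ)
  (increment_measurable u0 (ltW uv)) (brownian_increment_indep u0 uv mZ).
by rewrite sqr_sqrtr ?subr_ge0 ?(ltW uv)// mulrAC.
Qed.

Lemma increment_mean0 (u v : R) (Z : T -> R) : 0 <= u -> u <= v ->
  measurable_wrt (F u) Z ->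
  P.-integrable [set: T] (fun w => (Z w * (W v w - W u w))%:E) ->
  (\int[P]_w (Z w * (W v w - W u w))%:E = 0)%E.
Proof.
move=> u0; rewrite le_eqVlt => /predU1P[<-{v}|uv] mZ intZ.
  by rewrite integral0_eq// => w _; rewrite subrr mulr0.
have s0 : 0 < Num.sqrt (v - u) by rewrite sqrtr_gt0 subr_gt0.
exact: (gaussian_mul_mean0 s0 (measurable_of_wrt u0 mZ)
  (increment_measurable u0 (ltW uv)) (brownian_increment_indep u0 uv mZ)).
Qed.

Variables (u : nat -> R) (zeta : nat -> T -> R) (M : R).
Hypotheses (u0 : 0 <= u 0%N) (u_nd : forall i, u i <= u i.+1).
Hypothesis mzeta : forall i, measurable_wrt (F (u i)) (zeta i).
Hypothesis bzeta : forall i w, `|zeta i w| <= M.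

Let D i w := W (u i.+1) w - W (u i) w.
Let S n w := \sum_(i < n) zeta i w * D i w.

Let u_ge0 i : 0 <= u i.
Proof. by elim: i => // i /le_trans; exact. Qed.

Let u_mono i j : (i <= j)%N -> u i <= u j.
Proof. by move=> ij; apply: (homo_leq (@lexx _ _) (@le_trans _ _)) ij. Qed.

Let sF i : sigma_algebra setT (F (u i)).
Proof. exact: (filtration_sigma (brownian_filtration BM)). Qed.

Lemma stochastic_sum_adapted n : measurable_wrt (F (u n)) (S n).
Proof.
apply: (measurable_wrt_sum (sF n) (Y := fun i w => zeta i w * D i w)) => i ilt.
apply: (measurable_wrtM (sF n)).
  by apply: measurable_wrt_mono (mzeta i) => //; exact/u_mono/ltnW.
apply: (measurable_wrtB (sF n)).
  by apply: measurable_wrt_mono (brownian_adapted BM (u_ge0 _)) => //; exact/u_mono.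
by apply: measurable_wrt_mono (brownian_adapted BM (u_ge0 _)) => //; exact/u_mono/ltnW.
Qed.

Let mS n : measurable_fun [set: T] (S n).
Proof. exact: measurable_of_wrt (stochastic_sum_adapted n). Qed.

Let mz n : measurable_fun [set: T] (zeta n).
Proof. exact: measurable_of_wrt (mzeta n). Qed.

Let mD n : measurable_fun [set: T] (D n).
Proof. exact: increment_measurable. Qed.

Lemma integrable_sqr_mul (f g : T -> R) :
  measurable_fun [set: T] f -> measurable_fun [set: T] g ->
  P.-integrable [set: T] (fun w => (f w ^+ 2)%:E) ->
  P.-integrable [set: T] (fun w => (g w ^+ 2)%:E) ->
  P.-integrable [set: T] (fun w => (f w * g w)%:E).
Proof.
move=> mf mg intf intg.
apply: le_integrable (integrableD measurableT intf intg) => //.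
  by apply/measurable_EFinP; exact: measurable_funM.
move=> w _; rewrite -EFinD !abse_EFin lee_fin [leRHS]ger0_norm ?addr_ge0 ?sqr_ge0//.
by rewrite ler_norml; apply/andP; split; nra.
Qed.

Lemma integrable_of_sqr (f : T -> R) :
  measurable_fun [set: T] f ->
  P.-integrable [set: T] (fun w => (f w ^+ 2)%:E) ->
  P.-integrable [set: T] (fun w => (f w)%:E).
Proof.
move=> mf intf.
rewrite (_ : (fun w => _) = (fun w => (f w * 1)%:E)); last first.
  by apply/funext => w; rewrite mulr1.
apply: integrable_sqr_mul => //; under eq_fun do rewrite expr1n.
exact: finite_measure_integrable_cst.
Qed.

Let int_z2 n : P.-integrable [set: T] (fun w => (zeta n w ^+ 2)%:E).
Proof.
apply: (measurable_bounded_integrable (f := fun w => zeta n w ^+ 2)) => //.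
- by rewrite (le_lt_trans (probability_le1 _ _))// ltry.
- exact: measurable_funX.
exists (M ^+ 2); split; first exact: num_real.
move=> x Mx w _ /=; rewrite normrX (le_trans _ (ltW Mx))//.
by rewrite ler_sqr ?nnegrE// (le_trans _ (bzeta n w)).
Qed.

Let int_zD2 n : P.-integrable [set: T] (fun w => ((zeta n w * D n w) ^+ 2)%:E).
Proof.
apply/integrableP; split.
  by apply/measurable_EFinP; apply: measurable_funX; exact: measurable_funM.
under eq_integral do rewrite abse_EFin ger0_norm ?sqr_ge0//.
apply: le_lt_trans (increment_sqr_le _ _ (mzeta n)) _ => //.
have := integrable_lty measurableT (int_z2 n).
by move=> h; rewrite lte_mul_pinfty// lee_fin !mulr_ge0 ?sqrtr_ge0 ?subr_ge0.
Qed.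

Let int_S2 n : P.-integrable [set: T] (fun w => (S n w ^+ 2)%:E).
Proof.
elim: n => [|n ih].
  rewrite (_ : (fun w => _) = cst 0%E); first exact: integrable0.
  by apply/funext => w; rewrite /S big_ord0 expr0n.
have mzD : measurable_fun [set: T] (fun w => zeta n w * D n w).
  exact: measurable_funM.
rewrite (_ : (fun w => _) = (fun w => (S n w ^+ 2)%:E +
   ((zeta n w * D n w) ^+ 2)%:E + (2)%:E * (S n w * (zeta n w * D n w))%:E)%E).
  apply: integrableD => //; first exact: integrableD.
  apply: integrableZl => //; exact: integrable_sqr_mul.
by apply/funext => w; rewrite /S big_ord_recr/= -!EFinM -!EFinD; congr EFin; ring.
Qed.

(** Expanding the square of the last partial sum, the cross term has mean 0: [S n * zeta n] is known
    at time [u n], and [D n] is a centered increment independent of that past. *)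
Lemma stochastic_sum_sqr_le n :
  (\int[P]_w (S n w ^+ 2)%:E <=
   sq2%:E * \int[P]_w (\sum_(i < n) zeta i w ^+ 2 * (u i.+1 - u i))%:E)%E.
Proof.
have q0 : (0 <= sq2) by rewrite mulr_ge0 ?sqrtr_ge0.
elim: n => [|n ih].
  rewrite integral0_eq ?mule_ge0 ?lee_fin//.
    by apply: integral_ge0 => w _; rewrite big_ord0.
  by move=> w _; rewrite /S big_ord0 expr0n.
have mzD : measurable_fun [set: T] (fun w => zeta n w * D n w).
  exact: measurable_funM.
have int_SzD : P.-integrable [set: T] (fun w => (S n w * (zeta n w * D n w))%:E).
  exact: integrable_sqr_mul.
rewrite (_ : (\int[P]_w _ = \int[P]_w ((S n w ^+ 2)%:E +
   ((zeta n w * D n w) ^+ 2)%:E + (2)%:E * (S n w * (zeta n w * D n w))%:E))%E);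
  last first.
  apply: eq_integral => w _; rewrite /S big_ord_recr/= -!EFinM -!EFinD.
  by congr EFin; ring.
rewrite integralD//; [|exact: integrableD|exact: integrableZl].
rewrite integralD// integralZl//.
have -> : (\int[P]_w (S n w * (zeta n w * D n w))%:E = 0)%E.
  rewrite (_ : (\int[P]_w _ = \int[P]_w ((S n w * zeta n w) * D n w)%:E)%E);
    last by apply: eq_integral => w _; rewrite mulrA.
  apply: increment_mean0 => //.
    by apply: (measurable_wrtM (sF n)) => //; exact: stochastic_sum_adapted.
  by under eq_fun do rewrite -mulrA.
rewrite mule0 adde0.
rewrite (_ : (\int[P]_w (\sum_(i < n.+1) _)%:E =
  \int[P]_w ((\sum_(i < n) zeta i w ^+ 2 * (u i.+1 - u i))%:E +
    (u n.+1 - u n)%:E * (zeta n w ^+ 2)%:E))%E); last first.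
  by apply: eq_integral => w _; rewrite big_ord_recr/= -EFinM -EFinD mulrC.
have z0 i w : 0 <= zeta i w ^+ 2 * (u i.+1 - u i).
  by rewrite mulr_ge0 ?sqr_ge0 ?subr_ge0.
have msum : measurable_fun [set: T]
    (fun w => (\sum_(i < n) zeta i w ^+ 2 * (u i.+1 - u i))%:E).
  apply/measurable_EFinP; apply: measurable_sum => i.
  by apply: measurable_funM => //; exact: measurable_funX.
have mz2 : measurable_fun [set: T] (fun w => (zeta n w ^+ 2)%:E).
  by apply/measurable_EFinP; exact: measurable_funX.
rewrite ge0_integralD//; last 3 first.
- by move=> w _; rewrite lee_fin sumr_ge0.
- by move=> w _; rewrite -EFinM lee_fin mulrC.
- exact: emeasurable_funM.
rewrite ge0_integralZl//; last 2 first.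
- by move=> w _; rewrite lee_fin sqr_ge0.
- by rewrite lee_fin subr_ge0.
rewrite ge0_muleDr; last 2 first.
- by apply: integral_ge0 => w _; rewrite lee_fin sumr_ge0.
- by rewrite mule_ge0 ?lee_fin ?subr_ge0// integral_ge0// => w _;
    rewrite lee_fin sqr_ge0.
rewrite leeD// muleA -EFinM; exact: increment_sqr_le.
Qed.

(** A pathwise bound on the quadratic variation controls the second moment independently of the
    number of steps, of the grid and of the bound [M] on the coefficients. *)
Lemma stochastic_sum_bounded_sqr n (K : R) :
  (forall w, \sum_(i < n) zeta i w ^+ 2 * (u i.+1 - u i) <= K) ->
  P.-integrable [set: T] (fun w => (S n w ^+ 2)%:E) /\
  (\int[P]_w (S n w ^+ 2)%:E <= (sq2 * K)%:E)%E.
Proof.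
move=> leK; split=> //; apply: le_trans (stochastic_sum_sqr_le n) _.
rewrite [leRHS]EFinM lee_wpmul2l ?lee_fin ?mulr_ge0 ?sqrtr_ge0//.
apply: (@le_trans _ _ (\int[P]_w K%:E)%E); last first.
  by rewrite integral_cst//= probability_setT mule1.
apply: ge0_le_integral => //.
- move=> w _; rewrite lee_fin sumr_ge0// => i _.
  by rewrite mulr_ge0 ?sqr_ge0 ?subr_ge0.
- apply/measurable_EFinP; apply: measurable_sum => i.
  by apply: measurable_funM => //; exact: measurable_funX.
- by move=> w _; rewrite lee_fin.
Qed.

(** An event known at the initial time can be absorbed into every coefficient without losing
    adaptedness; this is the martingale property tested on C. *)
Lemma stochastic_sum_mean0 n (C : set T) : F (u 0%N) C ->
  (\int[P]_w (\1_C w * S n w)%:E = 0)%E.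
Proof.
move=> FC.
have mC i : measurable_wrt (F (u i)) (\1_C : T -> R).
  apply: (measurable_wrt_indic (sF i)).
  by apply: (filtration_mono (brownian_filtration BM) u0) FC; exact: u_mono.
have int_term i : P.-integrable [set: T]
    (fun w => (\1_C w * zeta i w * D i w)%:E).
  apply: le_integrable (integrable_of_sqr _ (int_zD2 i)) => //.
  - apply/measurable_EFinP; apply: measurable_funM => //; apply: measurable_funM => //.
    exact: measurable_of_wrt (mC i).
  - move=> w _; rewrite !abse_EFin lee_fin -mulrA normrM ler_piMl//.
    by rewrite indicE; case: (_ \in _); rewrite ?normr1 ?normr0.
  - exact: measurable_funM.
rewrite (_ : (\int[P]_w _ =
  \int[P]_w (\sum_(i < n) (\1_C w * zeta i w * D i w)%:E))%E); last first.
  apply: eq_integral => w _; rewrite /S mulr_sumr -sumEFin.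
  by apply: eq_bigr => i _; rewrite mulrA.
rewrite integral_sum//= big1// => i _; apply: increment_mean0 => //.
exact: (measurable_wrtM (sF i)).
Qed.

End stochastic_sums.

(** * Pathwise truncation of a simple integral by its quadratic variation *)

Section truncated_sums.
Context {R : realType}.
Variables (tau xi : nat -> R) (w : R -> R) (s t K : R).
Hypothesis tau_nd : forall i, tau i <= tau i.+1.
Hypothesis st : s <= t.

(** Projecting the grid onto [s, t] keeps only the part of the integral accumulated between s and
    t. *)
Definition clamp (a : R) : R := Num.max s (Num.min a t).
Definition partial_qv (n : nat) : R :=
  \sum_(i < n) xi i ^+ 2 * (Num.min (tau i.+1) t - Num.min (tau i) t).
(** The test looks one step ahead, but [partial_qv i.+1] involves only the coefficients up to i, so
    it is decided at time [tau i]. The condition [tau i <= t] ensures that this time is not later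
    than the clamped grid point. *)
Definition truncated (i : nat) : R :=
  if (tau i <= t) && (partial_qv i.+1 <= K) then xi i else 0.
Definition elementary (n : nat) (r : R) : R :=
  \sum_(i < n) xi i * (w (Num.min (tau i.+1) r) - w (Num.min (tau i) r)).
Definition truncated_sum (n : nat) : R :=
  \sum_(i < n) truncated i * (w (clamp (tau i.+1)) - w (clamp (tau i))).

Lemma clamp_le a b : a <= b -> clamp a <= clamp b.
Proof.
by move=> ab; rewrite /clamp ge_max !le_max lexx/= le_min !ge_min ab lexx !orbT.
Qed.

Lemma clamp_bounds a : s <= clamp a <= t.
Proof. by rewrite /clamp le_max lexx/= ge_max st ge_min lexx orbT. Qed.

Lemma le_clamp a : a <= t -> a <= clamp a.
Proof. by move=> at_; rewrite /clamp le_max le_min lexx at_ orbT. Qed.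

(** Differences of this identity turn a clamped increment into its contribution to [elementary] at t
    minus that at s. *)
Lemma clampE a : w (clamp a) = w (Num.min a t) - w (Num.min a s) + w s.
Proof.
rewrite /clamp; have [as_|sa] := leP a s.
- rewrite (min_idPl (le_trans as_ st)) (max_idPl as_); ring.
- by rewrite (max_idPr _) ?subrK// le_min (ltW sa).
Qed.

Lemma tau_mono i j : (i <= j)%N -> tau i <= tau j.
Proof. by move=> ij; apply: (homo_leq (@lexx _ _) (@le_trans _ _)) ij. Qed.

Lemma mesh_ge0 i : 0 <= Num.min (tau i.+1) t - Num.min (tau i) t.
Proof. by rewrite subr_ge0 le_min !ge_min lexx tau_nd orbT. Qed.

Lemma partial_qv_nd i : partial_qv i <= partial_qv i.+1.
Proof.
by rewrite /partial_qv big_ord_recr/= lerDl mulr_ge0 ?sqr_ge0 ?mesh_ge0.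
Qed.

(** Induction on n: if the last coefficient survives, the whole sum is at most [partial_qv n.+1],
    hence at most K; otherwise the last term is 0. *)
Lemma truncated_sqr_sum_le n : 0 <= K ->
  \sum_(i < n) truncated i ^+ 2 * (clamp (tau i.+1) - clamp (tau i)) <= K.
Proof.
move=> K0.
pose q i := xi i ^+ 2 * (Num.min (tau i.+1) t - Num.min (tau i) t).
have q0 i : 0 <= q i by rewrite mulr_ge0 ?sqr_ge0 ?mesh_ge0.
have le_term i : truncated i ^+ 2 * (clamp (tau i.+1) - clamp (tau i)) <=
    if partial_qv i.+1 <= K then q i else 0.
  rewrite /truncated; case: (partial_qv _ <= K); rewrite ?andbF ?expr0n ?mul0r//.
  case: (_ <= t) => /=; last by rewrite expr0n mul0r q0.
  rewrite ler_wpM2l ?sqr_ge0//.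
  rewrite /clamp; have := tau_nd i; move: (tau i) (tau i.+1) => a b ab.
  by rewrite /Num.max /Num.min; repeat case: ifP; lra.
apply: le_trans; first by apply: ler_sum => i _; exact: le_term.
elim: n => [|n ih]; first by rewrite big_ord0.
rewrite big_ord_recr/=; case: ifP => [leK|_]; last by rewrite addr0.
apply: le_trans leK; rewrite /partial_qv big_ord_recr/= lerD2r.
by apply: ler_sum => i _; case: ifP => // _; exact: q0.
Qed.

Lemma elementary_const n a r : tau n <= a -> a <= r ->
  elementary n a = elementary n r.
Proof.
move=> na ar; apply: eq_bigr => i _.
have h j : (j <= n)%N -> Num.min (tau j) a = Num.min (tau j) r.
  move=> jn; have ja : tau j <= a by rewrite (le_trans (tau_mono jn)).
  by rewrite (min_idPl ja) (min_idPl (le_trans ja ar)).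
by rewrite !h// ltnW.
Qed.

Lemma elementaryS_lt n r : r <= tau n -> elementary n.+1 r = elementary n r.
Proof.
move=> rn; rewrite /elementary big_ord_recr/=.
by rewrite (min_idPr rn) (min_idPr (le_trans rn (tau_nd n))) subrr mulr0 addr0.
Qed.

(* Truncation amounts to stopping the elementary integral at the first grid
   time whose coefficient would push the quadratic variation above K. *)
Lemma truncated_sumE n : 0 <= K -> exists2 r, s <= r <= t &
  truncated_sum n = elementary n r - elementary n s /\
  (partial_qv n <= K -> r = t).
Proof.
(* The added clause says that once K is exceeded the stopping point lies before [tau n] or is s
   itself, so later terms no longer affect the difference. *)
move=> K0; suff [r srt [E _ rt]] : exists2 r, s <= r <= t &
    [/\ truncated_sum n = elementary n r - elementary n s,
     (K < partial_qv n -> r = s \/ r <= tau n) & (partial_qv n <= K -> r = t)].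
  by exists r.
elim: n => [|n [r /andP[sr rt] [E rK rt']]].
  exists t; first by rewrite st lexx.
  split=> //.
    by rewrite /truncated_sum /elementary !big_ord0 subrr.
  by rewrite /partial_qv big_ord0 ltNge K0.
have ES : truncated_sum n.+1 = truncated_sum n +
    truncated n * (w (clamp (tau n.+1)) - w (clamp (tau n))).
  by rewrite /truncated_sum big_ord_recr.
have [leK|ltK] := leP (partial_qv n.+1) K.
  have leKn : partial_qv n <= K by rewrite (le_trans (partial_qv_nd n)).
  exists t; first by rewrite st lexx.
  split=> //.
  rewrite ES E (rt' leKn) /truncated leK andbT /elementary !big_ord_recr/=.
  case: ifP => [_|/negbT]; first by rewrite !clampE; ring.
  rewrite -ltNge => tn; have tn1 := lt_le_trans tn (tau_nd n).
  rewrite (min_idPr (ltW tn)) (min_idPr (ltW tn1)).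
  rewrite (min_idPr (le_trans st (ltW tn))) (min_idPr (le_trans st (ltW tn1))).
  by rewrite !subrr; ring.
have {}ES : truncated_sum n.+1 = truncated_sum n.
  by rewrite ES /truncated [_ <= K]leNgt ltK andbF mul0r addr0.
have [leKn|ltKn] := leP (partial_qv n) K; last first.
  exists r; first by rewrite sr.
  split=> //.
    rewrite ES E; case: (rK ltKn) => [->|rn]; first by rewrite !subrr.
    by rewrite !elementaryS_lt// (le_trans sr).
  by move=> _; case: (rK ltKn) => [->|rn]; [left|right; rewrite (le_trans rn)].
move: (rt' leKn) E => -> {r sr rt rK rt'} E.
(* Here step n is the first to push the quadratic variation above K, so the integral stops at its
   left endpoint, projected to [s, t]. *)
exists (clamp (tau n)); first exact: clamp_bounds.
split=> //.
  rewrite ES E /clamp; have [ns|sn] := leP (tau n) s.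
    rewrite (min_idPl (le_trans ns st)) (max_idPl ns) subrr.
    by rewrite (elementary_const ns st) subrr.
  have [nt|tn] := leP (tau n) t.
    rewrite (max_idPr (ltW sn)) !elementaryS_lt ?lexx ?(ltW sn)//.
    by rewrite (elementary_const (lexx _) nt).
  by rewrite (max_idPr st) !elementaryS_lt ?(ltW tn) ?(ltW sn).
move=> _; rewrite /clamp; have [ns|sn] := leP (tau n) s.
  by left; rewrite (min_idPl (le_trans ns st)) (max_idPl ns).
by right; rewrite ge_max (le_trans (ltW sn))//= (le_trans _ (tau_nd n))// ge_min lexx.
Qed.

End truncated_sums.

(** * Regularity and measurability of paths *)

Section grid.
Context {R : realType}.
Implicit Types (r t e : R) (g : R -> R) (n : nat).

(** Rounding down means that the approximation of a time r <= t never looks past t. *)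
Definition grid n r : R := (Num.truncn (r * n.+1%:R))%:R / n.+1%:R.

Lemma grid_bounds n r : 0 <= r -> 0 <= grid n r <= r.
Proof.
move=> r0; rewrite /grid divr_ge0//= ler_pdivrMr ?ltr0Sn//.
by rewrite truncn_le mulr_ge0.
Qed.

Lemma cvg_grid r : 0 <= r -> grid n r @[n --> \oo] --> r.
Proof.
move=> r0; apply/cvgrPdist_le => e e0.
have := @cvg_harmonic R => /cvgrPdist_le /(_ e e0) [N _ hN].
exists N => // n Nn; apply: le_trans (hN n Nn).
have /andP[_ gr] := grid_bounds n r0.
rewrite sub0r normrN /harmonic/= !ger0_norm ?subr_ge0//.
rewrite lerBlDl -[n.+1%:R^-1]mul1r /grid -mulrDl ler_pdivlMr ?ltr0Sn//.
have /andP[_ /ltW] := truncn_itv (mulr_ge0 r0 (ler0n R n.+1)).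
by rewrite -[(Num.truncn _).+1]addn1 natrD.
Qed.

Definition seq_continuous g := forall r (q : nat -> R), 0 <= r ->
  (forall n, 0 <= q n) -> q @ \oo --> r -> g (q n) @[n --> \oo] --> g r.

Lemma within_seq_continuous g :
  {within `[0, +oo[, continuous g} -> seq_continuous g.
Proof.
move=> /subspace_continuousP cg r q r0 q0 qr.
have gr := cg r _; apply: cvg_comp (gr _); last by rewrite /= in_itv/= r0.
move=> A wA; change (\forall n \near \oo, A (q n)).
have : \forall n \near \oo, `[0, +oo[%classic (q n) -> A (q n) := qr _ wA.
by apply: filterS => n; apply; rewrite /= in_itv/= q0.
Qed.

(** Strict inequalities persist at nearby grid points; this reduces conditions over all times in
    [0, t] to countably many. *)
Lemma grid_dense g t e r : seq_continuous g -> 0 <= r <= t -> e < g r ->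
  exists n k : nat, k%:R / n.+1%:R <= t /\ e < g (k%:R / n.+1%:R).
Proof.
move=> cg /andP[r0 rt] egr.
have q0 n : 0 <= grid n r by have /andP[] := grid_bounds n r0.
have /cvgr_gt/(_ _ egr) [n _ /(_ n (leqnn n)) en] := cg r (grid ^~ r) r0 q0 (cvg_grid r0).
exists n, (Num.truncn (r * n.+1%:R)); split=> //.
by have /andP[_ /le_trans] := grid_bounds n r0; exact.
Qed.

End grid.

Section joint_measurability.
Context {R : realType} {d : measure_display} {T : measurableType d}.
Variable X : R -> T -> R.
Hypotheses (mX : forall t, 0 <= t -> measurable_fun [set: T] (X t)).
Hypothesis cX : forall w, seq_continuous (X ^~ w).

(** X is the pointwise limit of processes frozen along the grid, each a countable union of
    measurable rectangles. The maximum with 0 discards negative times, where nothing is assumed. *)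
Lemma joint_measurable :
  measurable_fun [set: measurableTypeR R * T] (fun p => X (Num.max p.1 0) p.2).
Proof.
have max0 (r : R) : 0 <= Num.max r 0 by rewrite le_max lexx orbT.
refine (@measurable_fun_cvg _ (measurableTypeR R * T)%type R setT
  (fun n p => X (grid n (Num.max p.1 0)) p.2) _ _ _); last first.
  move=> [r w] _ /=; apply: cX => //; last exact: cvg_grid.
  by move=> n; have /andP[] := grid_bounds n (max0 r).
move=> n _ B mB; rewrite setTI.
pose lev k := [set r : R | Num.truncn (Num.max r 0 * n.+1%:R) = k].
rewrite (_ : _ @^-1` B = \bigcup_k (lev k `*` (X (k%:R / n.+1%:R) @^-1` B))).
  apply: bigcup_measurable => k _; apply: measurableX; last first.
    by rewrite -[X in measurable X]setTI; apply: mX => //; rewrite divr_ge0.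
  apply: is_interval_measurable => a b /= ak bk c /andP[ac cb].
  apply/eqP; rewrite eqn_leq -{1}bk -ak.
  by rewrite !le_truncn// ler_wpM2r// ge_max !le_max ?ac ?cb ?lexx ?orbT.
apply/seteqP; split=> [[r w] /= Bw|[r w] [k _ [/= <-]]//].
by exists (Num.truncn (Num.max r 0 * n.+1%:R)).
Qed.

End joint_measurability.

(** * Measurable path functionals and quadratic variation of the approximants *)

Section path_functionals.
Context {R : realType} {d : measure_display} {T : measurableType d}.
Local Notation leb := (@lebesgue_measure R).

Lemma measurable_sup_path_gt (Y : R -> T -> R) (t e : R) :
  (forall r, 0 <= r -> measurable_fun [set: T] (Y r)) ->
  (forall w, seq_continuous (Y ^~ w)) ->
  measurable [set w |
    (e%:E < ereal_sup [set (`|Y r w|)%:E | r in `[0%R, t]])%E].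
Proof.
move=> mY cY.
rewrite (_ : [set w | _] = \bigcup_n \bigcup_k
    [set w | k%:R / n.+1%:R <= t /\ e < `|Y (k%:R / n.+1%:R) w|]).
  apply: bigcup_measurable => n _; apply: bigcup_measurable => k _.
  have [kt|kt] := boolP (k%:R / n.+1%:R <= t); last first.
    by rewrite (_ : [set w | _] = set0)//; apply/seteqP; split=> // w [].
  rewrite (_ : [set w | _] =
      setT `&` (fun w => `|Y (k%:R / n.+1%:R) w|) @^-1` `]e, +oo[).
    by apply: measurableT_comp => //; apply: mY; rewrite divr_ge0.
  by rewrite setTI; apply/seteqP; split=> w /=; rewrite in_itv/= andbT; [case|split].
apply/seteqP; split=> [w /= /ereal_sup_gt[_ /= [r + <-]]|w [n _ [k _ [kt ekn]]]].
  rewrite in_itv/= lte_fin => r0t er.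
  have cg : seq_continuous (fun r => `|Y r w|).
    by move=> r' q r'0 q0 qr'; apply: cvg_norm; exact: cY.
  by have [n [k nk]] := grid_dense cg r0t er; exists n => //; exists k.
rewrite /= (lt_le_trans (_ : _ < (`|Y (k%:R / n.+1%:R) w|)%:E)%E) ?lte_fin//.
by apply: ereal_sup_ubound => /=; exists (k%:R / n.+1%:R) => //;
  rewrite in_itv/= kt divr_ge0.
Qed.

Lemma measurable_integral_sqr (Y : R -> T -> R) (t : R) :
  measurable_fun [set: measurableTypeR R * T] (fun p => Y p.1 p.2) ->
  measurable_fun [set: T] (fun w => \int[leb]_(s in `[0%R, t]) (Y s w ^+ 2)%:E)%E.
Proof.
move=> mY.
pose f (p : measurableTypeR R * T) : \bar R :=
  (Y p.1 p.2 ^+ 2 * \1_(`[0%R, t]%classic) p.1)%:E.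
rewrite (_ : (fun w => _) = fubini_G leb f); last first.
  apply/funext => w; rewrite integral_mkcond /fubini_G; apply: eq_integral => s _.
  rewrite /patch /f /= indicE; case: ifP => _; first by rewrite mulr1.
  by rewrite mulr0.
have f0 p : (0 <= f p)%E by rewrite lee_fin mulr_ge0 ?sqr_ge0.
apply: measurable_fun_fubini_tonelli_G => //.
apply/measurable_EFinP; apply: measurable_funM; first exact: measurable_funX.
apply: (measurableT_comp (f := \1_(`[0%R, t]%classic) : measurableTypeR R -> R)) => //.
Qed.

(** The intervals are disjoint, so at most one term is nonzero at r. *)
Lemma sqr_sum_indic (tau xi : nat -> R) (n : nat) (r : R) :
  (forall i, tau i <= tau i.+1) ->
  (\sum_(i < n) xi i * \1_(`]tau i, tau i.+1]%classic) r) ^+ 2 =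
  \sum_(i < n) xi i ^+ 2 * \1_(`]tau i, tau i.+1]%classic) r.
Proof.
move=> tau_nd; elim: n => [|n ih]; first by rewrite !big_ord0 expr0n.
rewrite !big_ord_recr/= indicE.
have [|_] := boolP (r \in _); last by rewrite !mulr0 !addr0.
rewrite inE/= in_itv/= => /andP[nr _].
have z i : (i < n)%N -> \1_(`]tau i, tau i.+1]%classic) r = 0 :> R.
  move=> ilt; rewrite indicE memNset//= in_itv/= => /andP[_].
  by rewrite leNgt (le_lt_trans _ nr)// tau_mono.
rewrite !big1 => [||i _]; rewrite ?z ?mulr0 ?add0r ?mulr1//.
by move=> i _; rewrite z ?mulr0.
Qed.

(** Bounds the quadratic variation of an approximant by its L^2 distance to the integrand h and the
    energy of h, through a^2 <= 2 (a - b)^2 + 2 b^2, which is (a - 2 b)^2 >= 0. *)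
Lemma partial_qv_le_integral (tau xi : nat -> R) (h : R -> R) (n : nat) (t : R) :
  (forall i, 0 <= tau i) -> (forall i, tau i <= tau i.+1) ->
  measurable_fun `[0, t] h ->
  ((partial_qv tau xi t n)%:E <=
   2%:E * \int[leb]_(s in `[0%R, t])
     ((\sum_(i < n) xi i * \1_(`]tau i, tau i.+1]%classic) s - h s) ^+ 2)%:E +
   2%:E * \int[leb]_(s in `[0%R, t]) (h s ^+ 2)%:E)%E.
Proof.
move=> tau0 tau_nd mh; pose sv s := \sum_(i < n) xi i * \1_(`]tau i, tau i.+1]%classic) s.
have msv : measurable_fun `[0, t] sv.
  by apply: measurable_sum => i; apply: measurable_funM.
have mh2 : measurable_fun `[0, t] (fun s => (h s ^+ 2)%:E).
  by apply/measurable_EFinP; exact: measurable_funX.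
have md2 : measurable_fun `[0, t] (fun s => ((sv s - h s) ^+ 2)%:E).
  by apply/measurable_EFinP; apply: measurable_funX; exact: measurable_funB.
apply: (@le_trans _ _ (\int[leb]_(s in `[0%R, t]) (sv s ^+ 2)%:E)%E); last first.
  rewrite -!ge0_integralZl//=; try (by move=> s _; rewrite lee_fin sqr_ge0).
  rewrite -ge0_integralD//=; last 4 first.
  - by move=> s _; rewrite -EFinM lee_fin mulr_ge0 ?sqr_ge0.
  - exact: emeasurable_funM.
  - by move=> s _; rewrite -EFinM lee_fin mulr_ge0 ?sqr_ge0.
  - exact: emeasurable_funM.
  apply: ge0_le_integral => //.
  - by move=> s _; rewrite lee_fin sqr_ge0.
  - by apply/measurable_EFinP; exact: measurable_funX.
  - by apply: emeasurable_funD; exact: emeasurable_funM.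
  - move=> s _; rewrite -!EFinM -EFinD lee_fin -/(sv s).
    by move: (sv s) (h s) => a b; have := sqr_ge0 (a - 2 * b); nra.
rewrite (_ : (\int[leb]_(s in _) _ = \int[leb]_(s in `[0%R, t])
    (\sum_(i < n) (xi i ^+ 2 * \1_(`]tau i, tau i.+1]%classic) s)%:E))%E); last first.
  by apply: eq_integral => s _; rewrite sumEFin /sv sqr_sum_indic.
rewrite ge0_integral_sum//=; last 2 first.
- by move=> i; apply/measurable_EFinP; apply: measurable_funM.
- by move=> i s _; rewrite lee_fin mulr_ge0 ?sqr_ge0.
rewrite /partial_qv -sumEFin; apply: lee_sum => i _.
under eq_integral do rewrite EFinM.
rewrite ge0_integralZl//=; last 2 first.
- by apply/measurable_EFinP; exact: measurable_indic.
- by rewrite lee_fin sqr_ge0.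
rewrite EFinM lee_wpmul2l ?lee_fin ?sqr_ge0// integral_indic//=.
apply: (@le_trans _ _
    (leb `]Num.min (tau i) t, Num.min (tau i.+1) t]%classic)).
  rewrite lebesgue_measure_itv/= lte_fin; case: ifPn => // /negbTE.
  by move/negbT; rewrite -leNgt lee_fin subr_le0.
apply: le_measure; rewrite ?inE//=.
  exact: measurableI.
move=> s /=; rewrite !in_itv/= !le_min => /andP[ls /andP[si st]].
have [ts|] := leP (tau i) t; move: ls.
- by rewrite (min_idPl ts) => ls; rewrite ls si st (le_trans (tau0 i) (ltW ls)).
- by move=> ls ti; move: ls; rewrite (min_idPr (ltW ti)) ltNge st.
Qed.

End path_functionals.

Section drift.
Context {R : realType}.
Local Notation leb := (@lebesgue_measure R).

(** The sign of mu enters through this comparison, with b = mu X: increments of X are at most those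
    of its Ito integral. *)
Lemma nonpositive_drift_le (b X I : R -> R) (x s t : R) :
  0 <= s <= t -> {within `[0, +oo[, continuous b} -> (forall r, 0 <= r -> b r <= 0) ->
  (forall r, 0 <= r -> X r = x + \int[leb]_(u in `[0, r]) b u + I r) ->
  X t - X s <= I t - I s.
Proof.
move=> /andP[s0 st] cb b0 XE.
have t0 := le_trans s0 st.
have intb : leb.-integrable `[0, t] (EFin \o b).
  apply: continuous_compact_integrable; first exact: segment_compact.
  apply: continuous_subspaceW cb => r /=; rewrite !in_itv/= => /andP[-> _]//.
suff : \int[leb]_(u in `[0, t]) b u <= \int[leb]_(u in `[0, s]) b u.
  by rewrite !XE//; lra.
rewrite -subr_le0 Rintegral_itvB ?bnd_simp//.
have -> : 0 = \int[leb]_(u in `]s, t]) (cst 0 : R -> R) u :> R.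
  by rewrite Rintegral_cst// mul0r.
apply: le_Rintegral => //.
- by apply: integrableS intb => //; apply: subset_itvr; rewrite bnd_simp.
- exact: integrable0.
by move=> r /=; rewrite in_itv/= => /andP[/ltW sr _]; rewrite b0// (le_trans s0).
Qed.

End drift.

Section truncated_simple_integral.
Context {R : realType} {d : measure_display} {T : measurableType d}.
Variables (P : probability T R) (F : R -> set (set T)) (W : R -> T -> R).
Hypothesis BM : brownian_motion P F W.
Variables (H : simple_process F) (s t K : R).
Hypotheses (s0 : 0 <= s) (st : s <= t) (K0 : 0 <= K).

Let tau := simple_time H.
Let xi w i := simple_coef H i w.
Let u i := clamp s t (tau i).
Let qv w n := partial_qv tau (xi w) t n.
Let zeta i w := truncated tau (xi w) t K i.

Let t0 : 0 <= t. Proof. exact: le_trans st. Qed.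

Let u0 i : 0 <= u i.
Proof. by have /andP[/(le_trans s0)] := clamp_bounds st (tau i). Qed.

Let tau0 i : 0 <= tau i. Proof. exact: simple_time_ge0. Qed.

Let mqv i : measurable_wrt (F (tau i)) (fun w => qv w i.+1).
Proof.
have sF := filtration_sigma (brownian_filtration BM) (tau0 i).
apply: (measurable_wrt_sum sF
  (Y := fun j w => xi w j ^+ 2 * (Num.min (tau j.+1) t - Num.min (tau j) t))) => j ji.
have mxi : measurable_wrt (F (tau i)) (xi ^~ j).
  apply: (measurable_wrt_mono BM (tau0 j)); last exact: simple_coef_measurable.
  by apply: tau_mono; first exact: simple_time_mono.
under eq_fun do rewrite expr2.
apply: (measurable_wrtM sF); last exact: measurable_wrt_cst.
exact: measurable_wrtM.
Qed.

Let mzeta i : measurable_wrt (F (u i)) (zeta i).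
Proof.
have sF := filtration_sigma (brownian_filtration BM) (u0 i).
rewrite /zeta /truncated; have [it|ti] := leP (tau i) t; last first.
  exact: measurable_wrt_cst.
have sFi := filtration_sigma (brownian_filtration BM) (tau0 i).
apply: (measurable_wrt_mono BM (tau0 i)); first exact: le_clamp.
rewrite (_ : (fun w => _) = (fun w => \1_[set w | qv w i.+1 <= K] w * xi w i)).
  apply: (measurable_wrtM sFi); last exact: simple_coef_measurable.
  apply: (measurable_wrt_indic sFi).
  rewrite (_ : [set w | _] = (fun w => qv w i.+1) @^-1` `]-oo, K]).
    by apply: mqv.
  by apply/seteqP; split=> w /=; rewrite in_itv.
apply/funext => w /=; rewrite -/(qv w i.+1) indicE.
have [leK|ltK] := leP (qv w i.+1) K; first by rewrite mem_set ?mul1r.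
by rewrite memNset ?mul0r//=; apply/negP; rewrite -ltNge.
Qed.

(** Combines the moments of N, bounded in terms of K and not of H, with its pathwise form: an
    increment of the simple integral of H up to a random time r, equal to t unless the level was
    exceeded. *)
Lemma truncated_simple_integral : exists N : T -> R,
  [/\ measurable_fun [set: T] N,
     P.-integrable [set: T] (fun w => (N w ^+ 2)%:E),
     (\int[P]_w (N w ^+ 2)%:E <= (4 * Num.sqrt 2 * K)%:E)%E,
     (forall C, F s C -> (\int[P]_w (\1_C w * N w)%:E = 0)%E) &
     forall w, exists2 r, s <= r <= t &
       N w = simple_integral H W r w - simple_integral H W s w /\
       (qv w (simple_size H) <= K -> r = t)].
Proof.
have [M bM] := simple_coef_bounded H.
have bzeta i w : `|zeta i w| <= `|M|.
  rewrite /zeta /truncated; case: ifP => _; last by rewrite normr0.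
  by rewrite (le_trans (bM i w))// ler_norm.
have u_nd i : u i <= u i.+1 by rewrite clamp_le// simple_time_mono.
pose N w := truncated_sum tau (xi w) (W ^~ w) s t K (simple_size H).
have [intN leN] := stochastic_sum_bounded_sqr BM (u0 0%N) u_nd mzeta bzeta
  (fun w => truncated_sqr_sum_le (xi w) s t (simple_time_mono H) (simple_size H) K0).
exists N; split => //.
- apply: (measurable_of_wrt BM (u0 (simple_size H))).
  exact: (stochastic_sum_adapted BM (u0 0%N) u_nd mzeta).
- move=> C FC; apply: (stochastic_sum_mean0 BM (u0 0%N) u_nd mzeta bzeta).
  apply: (filtration_mono (brownian_filtration BM) s0 _ FC).
  by have /andP[] := clamp_bounds st (tau 0%N).
- by move=> w; apply: truncated_sumE => //; exact: simple_time_mono.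
Qed.

End truncated_simple_integral.

(** * The supermartingale property *)

Section path_regularity.
Context {R : realType} {d : measure_display} {T : measurableType d}.

Lemma dist_minl_le (a b c : R) : `|Num.min a b - Num.min a c| <= `|b - c|.
Proof.
have h1 := ler_norm (b - c); have := ler_norm (c - b); rewrite distrC => h2.
rewrite ler_norml /Num.min; case: ltP => ?; case: ltP => ?;
  by apply/andP; split; lra.
Qed.

Lemma simple_integral_seq_continuous (F : R -> set (set T)) (H : simple_process F)
    (W : R -> T -> R) w :
  (forall w, seq_continuous (W ^~ w)) ->
  seq_continuous (fun r => simple_integral H W r w).
Proof.
move=> cW r q r0 q0 qr; rewrite /simple_integral.
have cmin a : 0 <= a -> W (Num.min a (q n)) w @[n --> \oo] --> W (Num.min a r) w.
  move=> a0; apply: cW.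
  - by rewrite le_min a0.
  - by move=> n; rewrite le_min a0 q0.
  - apply/cvgrPdist_le => e e0; move/cvgrPdist_le : qr => /(_ e e0).
    by apply: filterS => n; apply: le_trans; exact: dist_minl_le.
elim: (simple_size H) => [|m ih].
  by under eq_fun do rewrite big_ord0; rewrite big_ord0; exact: cvg_cst.
under eq_fun do rewrite big_ord_recr/=; rewrite big_ord_recr/=.
apply: cvgD => //; apply: cvgM; first exact: cvg_cst.
by apply: cvgB; apply: cmin; exact: simple_time_ge0.
Qed.

Lemma within_continuous_mull (k : R) (g : R -> R) (A : set R) :
  {within A, continuous g} -> {within A, continuous (fun r => k * g r)}.
Proof.
move=> /subspace_continuousP cg; apply/subspace_continuousP => r Ar.
by apply: cvgM; [exact: cvg_cst|exact: cg].
Qed.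

Lemma within_half_line_segment (g : R -> R) (t : R) :
  {within `[0, +oo[, continuous g} -> {within `[0, t], continuous g}.
Proof.
by apply: continuous_subspaceW => r /=; rewrite !in_itv/= => /andP[-> _].
Qed.

End path_regularity.

Section ereal_sequences.
Context {R : realType}.
Implicit Types u : nat -> \bar R.

Lemma limn_einf_ub u (B : \bar R) : (forall n, u n <= B)%E -> (limn_einf u <= B)%E.
Proof.
move=> uB; rewrite limn_einf_lim; apply: lime_le; first exact: is_cvg_einfs.
apply: nearW => n; apply: le_trans (uB n); apply: ereal_inf_lbound.
by exists n => /=.
Qed.

Lemma cvge0_near_lt u (e : R) : 0 < e -> u n @[n --> \oo] --> 0%E ->
  \forall n \near \oo, (u n < e%:E)%E.
Proof.
move=> e0 /fine_cvgP[ufin /cvgr_lt/(_ _ e0)] ult.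
by near=> n; rewrite -(@fineK _ (u n)) ?lte_fin; near: n.
Unshelve. all: by end_near. Qed.

End ereal_sequences.

(** * From simple integrals to the supermartingale inequality *)

Section nonneg_diffusion_supermartingale.
Context {R : realType} {d : measure_display} {T : measurableType d}.
Variables (P : probability T R) (F : R -> set (set T)) (W : R -> T -> R).
Variables (mu sigma x : R) (X : R -> T -> R).
Hypothesis BM : brownian_motion P F W.
Hypothesis mu0 : mu <= 0.
Hypothesis solX : sde_solution P F W (fun y => mu * y) (fun y => sigma * y) x X.
Hypothesis Xpos : forall t w, 0 <= t -> 0 < X t w.
Local Notation leb := (@lebesgue_measure R).

Let adX : adapted F X. Proof. by case: solX. Qed.
Let cX : continuous_paths X. Proof. by case: solX. Qed.

Let mX t : 0 <= t -> measurable_fun [set: T] (X t).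
Proof. by move=> t0; apply: (measurable_of_wrt BM t0); exact: adX. Qed.

Let scX w : seq_continuous (X ^~ w).
Proof. exact/within_seq_continuous/cX. Qed.

Let scW w : seq_continuous (W ^~ w).
Proof. exact/within_seq_continuous/(brownian_continuous BM). Qed.

Variables (s t : R).
Hypotheses (s0 : 0 <= s) (st : s <= t).

Let t0 : 0 <= t. Proof. exact: le_trans st. Qed.

Section one_step.
Variables (I : R -> T -> R) (H : simple_process F).
Hypotheses (adI : adapted F I) (cI : continuous_paths I).
Variable Nul : set T.
Hypotheses (mNul : measurable Nul) (PNul : P Nul = 0%E).
Hypothesis XE : forall w, ~ Nul w -> forall r, 0 <= r ->
  X r w = x + (\int[leb]_(u in `[0, r]) (mu * X u w)) + I r w.
Variables (C : set T) (j e lam : R).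
Hypotheses (FC : F s C) (j0 : 0 <= j) (e0 : 0 < e) (lam0 : 0 < lam).

Definition low_start := C `&` [set w | X s w <= j].
(** This event depends on the path up to t, so it cannot be placed in the conditioning event at time
    s as [low_start] is; it only multiplies the payoff. *)
Definition low_energy :=
  [set w | (\int[leb]_(r in `[0%R, t]) ((sigma * X r w) ^+ 2)%:E <= j%:E)%E].
Definition bad_integrand := [set w | (1%:E <
  \int[leb]_(r in `[0%R, t]) ((simple_val H r w - sigma * X r w) ^+ 2)%:E)%E].
Definition bad_integral := [set w | (e%:E <
  ereal_sup [set (`|simple_integral H W r w - I r w|)%:E | r in `[0%R, t]])%E].

Lemma low_start_adapted : F s low_start.
Proof.
have [sF0 sFC sFU] := filtration_sigma (brownian_filtration BM) s0.
have sF := filtration_sigma (brownian_filtration BM) s0.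
have := @measurableI _ (g_sigma_algebraType (F s)) C [set w | X s w <= j].
rewrite /measurable/= sigma_algebra_id//; apply => //.
rewrite (_ : [set w | _] = X s @^-1` `]-oo, j]); first exact: adX.
by apply/seteqP; split=> w /=; rewrite in_itv.
Qed.

Lemma measurable_low_start : measurable low_start.
Proof.
exact: (filtration_measurable (brownian_filtration BM) s0 low_start_adapted).
Qed.

Let joint_X : measurable_fun [set: measurableTypeR R * T]
  (fun p => X (Num.max p.1 0) p.2).
Proof. exact: joint_measurable mX scX. Qed.

Let path_max r w : `[0, t]%classic r -> X (Num.max r 0) w = X r w.
Proof. by rewrite /= in_itv/= => /andP[r0 _]; rewrite (max_idPl r0). Qed.

Lemma measurable_low_energy : measurable low_energy.
Proof.
pose Y r w := sigma * X (Num.max r 0) w.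
have mY : measurable_fun [set: T]
    (fun w => \int[leb]_(r in `[0%R, t]) (Y r w ^+ 2)%:E)%E.
  by apply: measurable_integral_sqr; exact: measurable_funM.
rewrite (_ : low_energy = setT `&`
    (fun w => \int[leb]_(r in `[0%R, t]) (Y r w ^+ 2)%:E)%E @^-1` `]-oo, j%:E]%classic).
  by apply: mY => //; exact: emeasurable_itv.
have YE w : (\int[leb]_(r in `[0%R, t]) ((sigma * X r w) ^+ 2)%:E =
    \int[leb]_(r in `[0%R, t]) (Y r w ^+ 2)%:E)%E.
  by apply: eq_integral => r /set_mem rt; rewrite /Y path_max.
by rewrite setTI; apply/seteqP; split=> w; rewrite /low_energy /= in_itv/= YE.
Qed.

Lemma measurable_bad_integrand : measurable bad_integrand.
Proof.
pose Y r w := simple_val H r w - sigma * X (Num.max r 0) w.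
have mY : measurable_fun [set: T]
    (fun w => \int[leb]_(r in `[0%R, t]) (Y r w ^+ 2)%:E)%E.
  apply: measurable_integral_sqr; apply: measurable_funB; last exact: measurable_funM.
  apply: measurable_sum => i; apply: measurable_funM.
    apply: (measurableT_comp (f := simple_coef H i)) => //.
    apply: (measurable_of_wrt BM (simple_time_ge0 H i)).
    exact: simple_coef_measurable.
  apply: (measurableT_comp (f := \1_(`]simple_time H i, simple_time H i.+1]%classic)
    : measurableTypeR R -> R)) => //.
rewrite (_ : bad_integrand = setT `&`
    (fun w => \int[leb]_(r in `[0%R, t]) (Y r w ^+ 2)%:E)%E @^-1` `]1%:E, +oo[%classic).
  by apply: mY => //; exact: emeasurable_itv.
have YE w : (\int[leb]_(r in `[0%R, t]) ((simple_val H r w - sigma * X r w) ^+ 2)%:E =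
    \int[leb]_(r in `[0%R, t]) (Y r w ^+ 2)%:E)%E.
  by apply: eq_integral => r /set_mem rt; rewrite /Y path_max.
by rewrite setTI; apply/seteqP; split=> w;
  rewrite /bad_integrand /= in_itv/= andbT YE.
Qed.

Lemma measurable_bad_integral : measurable bad_integral.
Proof.
apply: (measurable_sup_path_gt (Y := fun r w => simple_integral H W r w - I r w)).
  move=> r r0; apply: measurable_funB.
    apply: measurable_sum => i; apply: measurable_funM.
      apply: (measurable_of_wrt BM (simple_time_ge0 H i)).
      exact: simple_coef_measurable.
    by apply: measurable_funB; apply: (brownian_measurable BM);
      rewrite le_min r0 simple_time_ge0.
  by apply: (measurable_of_wrt BM r0); exact: adI.
move=> w r q r0 q0 qr; apply: cvgB.
  exact: simple_integral_seq_continuous.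
exact: (within_seq_continuous (@cI w)).
Qed.

(** Origin of the truncation level: twice the error threshold 1 plus twice the energy bound j. *)
Lemma qv_le_of_good w : low_energy w -> ~ bad_integrand w ->
  partial_qv (simple_time H) (simple_coef H ^~ w) t (simple_size H) <= 2 + 2 * j.
Proof.
move=> Ow /negP; rewrite -leNgt => Bw.
have mh : measurable_fun `[0, t] (fun r => sigma * X r w).
  apply: subspace_continuous_measurable_fun => //.
  exact/within_continuous_mull/within_half_line_segment/cX.
have := partial_qv_le_integral (simple_coef H ^~ w) (simple_size H)
  (simple_time_ge0 H) (simple_time_mono H) mh.
rewrite -lee_fin => /le_trans; apply.
have -> : ((2 + 2 * j)%:E = 2%:E * 1%:E + 2%:E * j%:E :> \bar R)%E.
  by rewrite -!EFinM -EFinD mulr1.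
by apply: leeD; apply: lee_wpmul2l.
Qed.

(** At the random stopping time r, X_r - X_s <= I_r - I_s <= N + 2 e, with one e for each endpoint;
    this is why the convergence must be uniform in time. Positivity of X_r gives the first bound,
    and r = t on the good event gives the second. *)
Lemma truncated_integral_lower_bound w N :
  ~ Nul w -> ~ bad_integral w ->
  (exists2 r, s <= r <= t &
     N = simple_integral H W r w - simple_integral H W s w /\
     (partial_qv (simple_time H) (simple_coef H ^~ w) t (simple_size H)
       <= 2 + 2 * j -> r = t)) ->
  0 <= X s w + N + 2 * e /\
  (low_energy w -> ~ bad_integrand w -> X t w <= X s w + N + 2 * e).
Proof.
move=> Nw /negP; rewrite -leNgt => Bw [r /andP[sr rt] [NE rt']].
have close v : 0 <= v <= t -> `|simple_integral H W v w - I v w| <= e.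
  move=> v0t; rewrite -lee_fin; apply: le_trans Bw.
  by apply: ereal_sup_ubound => /=; exists v => //; rewrite in_itv.
have r0 : 0 <= r by rewrite (le_trans s0).
have drift : X r w - X s w <= I r w - I s w.
  apply: (@nonpositive_drift_le _ (fun r => mu * X r w) (X ^~ w) (I ^~ w) x).
  - by rewrite s0.
  - exact/within_continuous_mull/cX.
  - by move=> v v0; rewrite mulr_le0_ge0// ltW// Xpos.
  - exact: XE.
have le : X r w <= X s w + N + 2 * e.
  have /ler_normlP[c1 c2] : `|simple_integral H W r w - I r w| <= e.
    by apply: close; rewrite r0.
  have /ler_normlP[c3 c4] : `|simple_integral H W s w - I s w| <= e.
    by apply: close; rewrite s0.
  by rewrite NE; lra.
split; first by rewrite (le_trans _ le)// ltW// Xpos.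
by move=> Ow Bw'; rewrite -(rt' (qv_le_of_good Ow Bw')).
Qed.

(* Off the bad events X_s + N + 2e dominates both 0 and the truncated payoff,
   where N is the truncated integral over [s, t]; on the bad events, N itself is
   absorbed by AM-GM: 0 <= N + N^2 / lam + lam. *)
Lemma truncated_payoff_le :
  (\int[P]_w (\1_low_start w * (\1_low_energy w * Num.min (X t w) j))%:E <=
   \int[P]_w (\1_low_start w * X s w)%:E +
   ((2 * e + lam^-1 * (4 * Num.sqrt 2 * (2 + 2 * j)))%:E +
    (lam + j)%:E * (P bad_integrand + P bad_integral)))%E.
Proof.
have K0 : 0 <= 2 + 2 * j by rewrite addr_ge0// mulr_ge0.
have [N [mN intN2 leN mean0 NE]] := truncated_simple_integral BM H s0 st K0.
have mls := measurable_low_start; have mle := measurable_low_energy.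
have mb1 := measurable_bad_integrand; have mb2 := measurable_bad_integral.
have indic01 (A : set T) w : (0 <= \1_A w :> R) && (\1_A w <= 1 :> R).
  by rewrite indicE; case: (_ \in _); rewrite ?lexx ?ler01.
have mind (A : set T) : measurable A -> measurable_fun [set: T] (\1_A : T -> R).
  exact: measurable_indic.
pose a w := \1_low_start w * X s w.
pose b w := \1_low_start w * N w.
pose p w : R := \1_bad_integrand w + \1_bad_integral w.
have ma : measurable_fun [set: T] a.
  by apply: measurable_funM; [exact: mind|exact: mX].
have mb : measurable_fun [set: T] b by apply: measurable_funM => //; exact: mind.
have mp : measurable_fun [set: T] p by apply: measurable_funD; exact: mind.
have inta : P.-integrable [set: T] (EFin \o a).
  apply: (@le_integrable _ _ _ P setT measurableT (EFin \o a) (cst j%:E)) => //.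
  - by apply/measurable_EFinP.
  - move=> w _; rewrite /= lee_fin /a indicE; have [|_] := boolP (w \in _).
      rewrite inE => -[_ /= Xj]; rewrite mul1r ger0_norm; last by rewrite ltW// Xpos.
      by rewrite ger0_norm.
    by rewrite mul0r normr0.
  - exact: finite_measure_integrable_cst.
have intb : P.-integrable [set: T] (EFin \o b).
  apply: (@le_integrable _ _ _ P setT measurableT (EFin \o b) (EFin \o N)) => //.
  - by apply/measurable_EFinP.
  - move=> w _; rewrite /= lee_fin /b normrM ler_piMl//.
    by have /andP[i0 i1] := indic01 low_start w; rewrite ger0_norm.
  - exact: (integrable_of_sqr mN intN2).
have intp : P.-integrable [set: T] (EFin \o p).
  apply: (@le_integrable _ _ _ P setT measurableT (EFin \o p) (cst 2%:E)) => //.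
  - by apply/measurable_EFinP.
  - move=> w _; rewrite /= lee_fin /p.
    have /andP[i0 i1] := indic01 bad_integrand w.
    have /andP[k0 k1] := indic01 bad_integral w.
    rewrite ger0_norm ?addr_ge0// ger0_norm//.
    by apply: le_trans (lerD i1 k1) _; rewrite -(natrD _ 1 1).
  - exact: finite_measure_integrable_cst.
(* The majorant: b has mean 0, the N^2 term is paid by the L^2 bound, and a bad event is charged lam
   for AM-GM plus j for the payoff itself. *)
pose G w := a w + b w + (2 * e + lam^-1 * N w ^+ 2 + (lam + j) * p w).
have mG : measurable_fun [set: T] G.
  have m1 : measurable_fun [set: T] (fun w => lam^-1 * N w ^+ 2).
    by apply: measurable_funM => //; exact: measurable_funX.
  have m2 : measurable_fun [set: T] (fun w => (lam + j) * p w).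
    exact: measurable_funM.
  exact: (measurable_funD (measurable_funD ma mb)
    (measurable_funD (measurable_funD (measurable_cst (2 * e)) m1) m2)).
have boundG w : ~ Nul w ->
    \1_low_start w * (\1_low_energy w * Num.min (X t w) j) <= G w.
  move=> Nw; rewrite /G /a /b /p.
  have Xs0 : 0 < X s w by exact: Xpos.
  have q0 : 0 <= lam^-1 * N w ^+ 2 by rewrite mulr_ge0 ?invr_ge0 ?sqr_ge0// ltW.
  have amgm : 0 <= N w + lam^-1 * N w ^+ 2 + lam.
    have : 0 <= lam^-1 * ((N w + lam / 2) ^+ 2 + 3 / 4 * lam ^+ 2).
      by rewrite mulr_ge0 ?invr_ge0 ?ltW// ltr_wpDl ?sqr_ge0// mulr_gt0// exprn_gt0.
    suff -> : lam^-1 * ((N w + lam / 2) ^+ 2 + 3 / 4 * lam ^+ 2) =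
      N w + lam^-1 * N w ^+ 2 + lam by [].
    by field; rewrite gt_eqF.
  have minj : Num.min (X t w) j <= j by rewrite ge_min lexx orbT.
  have minX : Num.min (X t w) j <= X t w by rewrite ge_min lexx.
  have lj : 0 <= lam + j by rewrite addr_ge0// ltW.
  have e2 : 0 <= 2 * e by rewrite mulr_ge0// ltW.
  have /andP[b1 _] := indic01 bad_integrand w.
  have /andP[b2 _] := indic01 bad_integral w.
  have [Cw|Cw] := boolP (w \in low_start); last first.
    rewrite [\1_low_start w]indicE (negbTE Cw) !mul0r !add0r.
    by apply: addr_ge0; [exact: addr_ge0|apply: mulr_ge0 => //; exact: addr_ge0].
  have mbad (y z : R) : 0 <= y -> 1 <= z -> lam + j <= (lam + j) * (y + z).
    by move=> y0 z1; rewrite ler_peMr// (le_trans z1)// lerDr.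
  rewrite [\1_low_start w]indicE Cw !mul1r.
  have Lj : \1_low_energy w * Num.min (X t w) j <= j.
    have /andP[i0 i1] := indic01 low_energy w.
    by rewrite (le_trans _ minj)// ler_piMl// le_min j0 ltW// Xpos.
  have [Bw|/negP Bw] := boolP (w \in bad_integral).
    have := mbad _ 1 b1 (lexx 1).
    have -> : \1_bad_integral w = 1 :> R by rewrite indicE Bw.
    move: (_ * (_ + 1)) => z; lra.
  have [h1 h2] := truncated_integral_lower_bound Nw (fun b => Bw (mem_set b)) (NE w).
  have [B'w|/negP B'w] := boolP (w \in bad_integrand).
    have := mbad _ 1 b2 (lexx 1); rewrite [_ + 1]addrC.
    have -> : \1_bad_integrand w = 1 :> R by rewrite indicE B'w.
    move: (_ * (1 + _)) => z; lra.
  have p0 : 0 <= (lam + j) * (\1_bad_integrand w + \1_bad_integral w).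
    by rewrite mulr_ge0// addr_ge0.
  have [Ow|Ow] := boolP (w \in low_energy); rewrite [\1_low_energy w]indicE.
    rewrite Ow mul1r (le_trans minX)//.
    by have := h2 (set_mem Ow) (fun b => B'w (mem_set b)); lra.
  by rewrite (negbTE Ow) mul0r; lra.
have intG : (\int[P]_w (G w)%:E = \int[P]_w (a w)%:E +
    ((2 * e)%:E + (lam^-1)%:E * \int[P]_w (N w ^+ 2)%:E +
     (lam + j)%:E * (P bad_integrand + P bad_integral)))%E.
  have ik : P.-integrable [set: T] (cst (2 * e)%:E).
    exact: finite_measure_integrable_cst.
  have iN : P.-integrable [set: T] (fun w => (lam^-1)%:E * (N w ^+ 2)%:E)%E.
    exact: integrableZl.
  have ip : P.-integrable [set: T] (fun w => (lam + j)%:E * (p w)%:E)%E.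
    exact: integrableZl.
  rewrite (_ : (\int[P]_w (G w)%:E = \int[P]_w (((a w)%:E + (b w)%:E) +
     (((2 * e)%:E + (lam^-1)%:E * (N w ^+ 2)%:E) + (lam + j)%:E * (p w)%:E)))%E);
    last by apply: eq_integral => w _; rewrite -!EFinM -!EFinD.
  rewrite integralD//; [|exact: integrableD|by apply: integrableD => //; exact: integrableD].
  rewrite integralD// [X in (_ + X + _)%E](mean0 _ low_start_adapted) adde0.
  rewrite integralD//; last exact: integrableD.
  rewrite integralD// integral_cst//= probability_setT mule1 !integralZl//.
  congr (_ + (_ + _ * _))%E.
  rewrite (_ : (\int[P]_w _ =
    \int[P]_w ((\1_bad_integrand w)%:E + (\1_bad_integral w)%:E))%E);
    last by apply: eq_integral => w _; rewrite -EFinD.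
  rewrite ge0_integralD//; [|by apply/measurable_EFinP; exact: mind..].
  by rewrite !integral_indic// !setIT.
rewrite (@le_trans _ _ (\int[P]_w (G w)%:E)%E)//; last first.
  rewrite intG leeD2l// leeD2r// EFinD leeD2l// EFinM lee_wpmul2l//.
  by rewrite lee_fin invr_ge0 ltW.
have mL : measurable_fun [set: T]
    (fun w => (\1_low_start w * (\1_low_energy w * Num.min (X t w) j))%:E).
  apply/measurable_EFinP; apply: measurable_funM; first exact: mind.
  apply: measurable_funM; first exact: mind.
  by apply: measurable_minr => //; exact: mX.
have L0 w : 0 <= \1_low_start w * (\1_low_energy w * Num.min (X t w) j).
  have /andP[i0 _] := indic01 low_start w.
  have /andP[k0 _] := indic01 low_energy w.
  by rewrite !mulr_ge0// le_min j0 ltW// Xpos.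
(* G is known to be nonnegative only off [Nul]; its positive part has the same integral and fits the
   comparison of nonnegative functions. *)
rewrite (_ : (\int[P]_w (G w)%:E = \int[P]_w (Num.max (G w) 0)%:E)%E); last first.
  apply: ae_eq_integral => //; [exact/measurable_EFinP| |].
    by apply/measurable_EFinP; exact: measurable_maxr.
  exists Nul; split=> // w /= Gw; apply: contrapT => Nw; apply: Gw => _.
  by congr EFin; rewrite (max_idPl _)// (le_trans (L0 w))// boundG.
apply: ae_ge0_le_integral => //.
- by move=> w _; rewrite lee_fin L0.
- by move=> w _; rewrite lee_fin le_max lexx orbT.
- by apply/measurable_EFinP; exact: measurable_maxr.
exists Nul; split=> // w /= Gw; apply: contrapT => Nw; apply: Gw => _.
by rewrite lee_fin le_max boundG.
Qed.

End one_step.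

Let finite_energy w :
  (\int[leb]_(r in `[0%R, t]) ((sigma * X r w) ^+ 2)%:E < +oo)%E.
Proof.
apply: (@integrable_lty _ _ _ leb `[0, t]%classic) => //.
apply: (continuous_compact_integrable (f := fun r => (sigma * X r w) ^+ 2)).
  exact: segment_compact.
apply: within_half_line_segment; apply/subspace_continuousP => r r0.
have /subspace_continuousP/(_ r r0) c := @cX w.
by apply: cvgM; (apply: cvgM; [exact: cvg_cst|exact: c]).
Qed.

(** The order of limits matters: the error is sent to 0 along the approximating processes at a fixed
    level m, and only then does m grow, by Fatou. *)
Theorem diffusion_supermartingale (C : set T) : F s C ->
  (\int[P]_(w in C) (X t w)%:E <= \int[P]_(w in C) (X s w)%:E)%E.
Proof.
move=> FC.
have mC : measurable C by exact: (filtration_measurable (brownian_filtration BM) s0).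
have [_ _ _ [I [adI cI [Hn cvgH]] [Nul [mNul PNul subNul]]]] := solX.
have XE w : ~ Nul w -> forall r, 0 <= r ->
    X r w = x + (\int[leb]_(u in `[0, r]) (mu * X u w)) + I r w.
  by move=> Nw; apply: contrapT => h; exact/Nw/subNul.
have indicM (A : set T) (Z : T -> R) : measurable A ->
    (\int[P]_w (\1_A w * Z w)%:E = \int[P]_(w in A) (Z w)%:E)%E.
  move=> mA; rewrite [RHS]integral_mkcond; apply: eq_integral => w _.
  by rewrite /patch indicE; case: ifP => _; rewrite ?mul1r ?mul0r.
pose L m w := \1_(low_start C m%:R) w *
  (\1_(low_energy m%:R) w * Num.min (X t w) m%:R).
have mls m : measurable (low_start C m%:R) by exact: measurable_low_start.
have mle m : measurable (low_energy m%:R) by exact: measurable_low_energy.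
have leL m : (\int[P]_w (L m w)%:E <= \int[P]_(w in C) (X s w)%:E)%E.
  apply: (@le_trans _ _ (\int[P]_(w in low_start C m%:R) (X s w)%:E)%E); last first.
    apply: ge0_subset_integral => //.
    - by apply/measurable_EFinP; apply: measurable_funTS; exact: mX.
    - by move=> w _; rewrite lee_fin ltW// Xpos.
    - by move=> w [].
  rewrite -indicM//; apply/lee_addgt0Pr => eta eta0.
  (* The budget eta is split in three: lam makes K / lam = eta / 3, e makes 2 e = eta / 3, and del
     makes the two bad events cost 2 e together. *)
  pose K : R := 4 * Num.sqrt 2 * (2 + 2 * m%:R).
  have K0 : 0 < K.
    by rewrite !mulr_gt0 ?sqrtr_gt0// ltr_pwDl// mulr_ge0.
  pose lam : R := 3 * K / eta.
  have lam0 : 0 < lam by rewrite divr_gt0// mulr_gt0.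
  pose e := eta / 6.
  have e0 : 0 < e by rewrite divr_gt0.
  pose del := e / (lam + m%:R).
  have lm0 : 0 < lam + m%:R by rewrite ltr_pwDl.
  have del0 : 0 < del by rewrite divr_gt0.
  have [/(_ 1 ltr01)/(cvge0_near_lt del0) c1 /(_ e e0)/(cvge0_near_lt del0) c2] := cvgH t t0.
  have [n [p1 p2]] : exists n,
      (P (bad_integrand (Hn n)) < del%:E /\ P (bad_integral I (Hn n) e) < del%:E)%E.
    have [N _ hN] := filterI c1 c2.
    by exists N; have [] := hN N (leqnn N).
  have := truncated_payoff_le (Hn n) adI cI mNul PNul XE FC (ler0n R m) e0 lam0.
  move=> /le_trans; apply; rewrite leeD2l//.
  have -> : (eta%:E = (2 * e + lam^-1 * K)%:E + (lam + m%:R)%:E * (del%:E + del%:E))%E.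
    rewrite -[RHS]/((2 * e + lam^-1 * K + (lam + m%:R) * (del + del))%:E).
    congr EFin; rewrite /del; have -> : lam^-1 * K = eta / 3.
      by rewrite /lam; field; rewrite !gt_eqF.
    by rewrite /e; field; rewrite gt_eqF.
  by rewrite leeD2l// lee_wpmul2l ?lee_fin ?(ltW lm0)// leeD// ltW.
(* Each path has finite energy on [0, t], so for large m every truncation in [L m] is inactive and
   the sequence is eventually constant. *)
rewrite -indicM//; apply: (@le_trans _ _ (\int[P]_w limn_einf (fun m => (L m w)%:E))%E).
  rewrite le_eqVlt; apply/orP; left; apply/eqP; apply: eq_integral => w _.
  apply/esym; apply: (cvg_limn_einf_sup _).1; apply: cvg_near_cst.
  have [Cw|Cw] := boolP (w \in C); last first.
    apply: nearW => m; rewrite /L [\1_(low_start C m%:R) w]indicE.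
    rewrite [\1_C w]indicE (negbTE Cw) memNset ?mul0r// => -[Cw' _].
    by move: Cw; rewrite mem_set.
  pose En := (\int[leb]_(r in `[0%R, t]) ((sigma * X r w) ^+ 2)%:E)%E.
  have En_fin : En \is a fin_num.
    by rewrite ge0_fin_numE ?finite_energy// integral_ge0// => r _; rewrite lee_fin sqr_ge0.
  near=> m; rewrite /L [\1_(low_start C m%:R) w]indicE mem_set; last first.
    split; first exact: set_mem.
    by rewrite /=; near: m; exact: nbhs_infty_ger.
  rewrite [\1_(low_energy m%:R) w]indicE mem_set; last first.
    rewrite /low_energy /= -/En -(fineK En_fin) lee_fin.
    by near: m; exact: nbhs_infty_ger.
  rewrite [\1_C w]indicE Cw !mul1r (min_idPl _)//.
  by near: m; exact: nbhs_infty_ger.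
apply: le_trans (limn_einf_ub leL); apply: fatou => //.
- move=> m; apply/measurable_EFinP; apply: measurable_funM; first exact: measurable_indic.
  apply: measurable_funM; first exact: measurable_indic.
  by apply: measurable_minr => //; exact: mX.
- move=> m w _; rewrite lee_fin !mulr_ge0// ?indicE ?ler0n//.
  by rewrite le_min ler0n ltW// Xpos.
Unshelve. all: by end_near. Qed.

End nonneg_diffusion_supermartingale.

(** * Hitting events and optional stopping *)

Section path_hits.
Context {R : realType} {d : measure_display} {T : measurableType d}.
Implicit Types (X Y : R -> T -> R) (B U : set R) (t : R).

(** Time 0 is included, unlike in the hitting time; the two notions are compatible because the
    starting point is later taken outside B. *)
Definition hit X B t : set T := [set w | exists2 r, 0 <= r <= t & B (X r w)].

Lemma subset_hit X B s t : s <= t -> hit X B s `<=` hit X B t.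
Proof.
by move=> st w [r /andP[r0 rs] Br]; exists r => //; rewrite r0 (le_trans rs).
Qed.

Section adapted.
Variables (F : R -> set (set T)) (t : R).
Hypotheses (filF : filtration F) (t0 : 0 <= t).

Let FtE A : F t A = @measurable _ (g_sigma_algebraType (F t)) A.
Proof.
by rewrite /measurable/= sigma_algebra_id//; exact: filtration_sigma.
Qed.

Variable Y : R -> T -> R.
Hypotheses (adY : adapted F Y) (cY : continuous_paths Y).

Let hit_gt a : F t (hit Y `]a, +oo[ t).
Proof.
rewrite (_ : hit _ _ _ = \bigcup_n \bigcup_k
    [set w | k%:R / n.+1%:R <= t /\ a < Y (k%:R / n.+1%:R) w]).
  rewrite FtE; apply: bigcup_measurable => n _; apply: bigcup_measurable => k _.
  have [kt|kt] := boolP (k%:R / n.+1%:R <= t); last first.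
    by rewrite (_ : [set w | _] = set0)//; apply/seteqP; split=> // w [].
  rewrite (_ : [set w | _] = Y (k%:R / n.+1%:R) @^-1` `]a, +oo[); last first.
    by apply/seteqP; split=> w /=; rewrite in_itv/= andbT; [case|].
  rewrite -FtE; apply: (filtration_mono filF _ kt); first by rewrite divr_ge0.
  by apply: adY => //; rewrite divr_ge0.
apply/seteqP; split=> [w [r r0t]|w [n _ [k _ [kt ak]]]].
  rewrite /= in_itv/= andbT => ar.
  have [n [k nk]] := grid_dense (within_seq_continuous (@cY w)) r0t ar.
  by exists n => //; exists k.
exists (k%:R / n.+1%:R); first by rewrite kt divr_ge0.
by rewrite /= in_itv/= ak.
Qed.

(* As path maxima are attained, the path hits [a, +oo[ iff it hits every
   ]a - 1/n, +oo[, and hitting an open half-line is seen on rational times. *)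
Lemma hit_up_closed_adapted U : (forall y z, U y -> y <= z -> U z) ->
  F t (hit Y U t).
Proof.
move=> upU.
have maxY w : exists2 c, 0 <= c <= t & forall r, 0 <= r <= t -> Y r w <= Y c w.
  have [c + maxc] := EVT_max t0 (within_half_line_segment (@cY w)).
  rewrite in_itv/= => c0t; by exists c => // r r0t; exact: maxc.
(* An upward closed set is empty, the whole line, or a half-line that contains its infimum or
   not. *)
have [->|/set0P[u0 Uu0]] := eqVneq U set0.
  rewrite (_ : hit _ _ _ = set0); first by rewrite FtE.
  by apply/seteqP; split=> // w [].
have [lbU|nlbU] := pselect (has_lbound U); last first.
  rewrite (_ : hit _ _ _ = setT); first by rewrite FtE.
  apply/seteqP; split=> // w _; exists 0; first by rewrite lexx.
  apply: contrapT => nU; apply: nlbU; exists (Y 0 w) => y Uy.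
  by rewrite leNgt; apply/negP => /ltW yY; apply: nU; exact: upU yY.
have infU : U !=set0 by exists u0.
have gtU y : inf U < y -> U y.
  by move=> /(inf_lt infU)[v Uv vy]; apply: upU (ltW vy).
have [Ui|nUi] := pselect (U (inf U)).
  rewrite (_ : hit _ _ _ = \bigcap_n hit Y `](inf U - n.+1%:R^-1), +oo[ t).
    by rewrite FtE; apply: bigcap_measurableType => n _; rewrite -FtE.
  apply/seteqP; split=> w.
    move=> [r r0t Ur] n _; exists r => //; rewrite /= in_itv/= andbT.
    by rewrite ltrBlDr (le_lt_trans (ge_inf lbU Ur))// ltrDl invr_gt0.
  move=> hn; have [c c0t maxc] := maxY w; exists c => //.
  apply: upU Ui _; apply/ler_addgt0Pr => e e0.
  have [n en] : exists n, n.+1%:R^-1 < e :> R.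
    have /cvgr_lt/(_ _ e0)[n _ /(_ n (leqnn n))] := @cvg_harmonic R.
    by exists n.
  have [r r0t] := hn n Logic.I; rewrite /= in_itv/= andbT ltrBlDr => h.
  by rewrite (le_trans (ltW h))// lerD ?maxc// ltW.
rewrite (_ : U = `]inf U, +oo[%classic)//.
apply/seteqP; split=> y /=; rewrite in_itv/= andbT; last exact: gtU.
move=> Uy; rewrite lt_neqAle ge_inf// andbT.
by apply/eqP => yE; apply: nUi; rewrite yE.
Qed.

End adapted.

(* By the intermediate value theorem, a path from x hits B iff it goes above
   a point of B above x, or below a point of B below x. *)
Lemma hit_adapted (F : R -> set (set T)) X (x t : R) B :
  filtration F -> adapted F X -> continuous_paths X ->
  (forall w, X 0 w = x) -> 0 <= t -> F t (hit X B t).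
Proof.
move=> filF adX cX X0 t0.
pose U := [set y | exists2 b, B b & x <= b <= y].
(* Stated for the reflected path - X, so that it is upward closed like [U]. *)
pose L := [set y | exists2 b, B b & - y <= b <= x].
have FtE A : F t A = @measurable _ (g_sigma_algebraType (F t)) A.
  by rewrite /measurable/= sigma_algebra_id//; exact: filtration_sigma.
rewrite (_ : hit X B t = hit X U t `|` hit (fun r w => - X r w) L t).
  rewrite FtE; apply: measurableU; rewrite -FtE.
    apply: hit_up_closed_adapted => // y z [b Bb /andP[xb b_y]] yz.
    by exists b => //; rewrite xb (le_trans b_y).
  apply: hit_up_closed_adapted => //.
  - move=> r r0 C mC; have := adX r r0 (-%R @^-1` C).
    by apply; rewrite -[X in measurable X]setTI; exact: oppr_measurable.
  - move=> w; apply/subspace_continuousP => r r0; apply: cvgN.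
    by have /subspace_continuousP := @cX w; exact.
  - move=> y z [b Bb /andP[yb bx]] yz; exists b => //.
    by rewrite bx andbT (le_trans _ yb)// lerN2.
have ivt w r b : 0 <= r <= t -> Num.min x (X r w) <= b <= Num.max x (X r w) ->
    B b -> hit X B t w.
  move=> /andP[r0 rt] xb Bb.
  have [c + cb] := IVT r0 (within_half_line_segment (@cX w)) (v := b)
    (eq_ind_r (fun z => Num.min z _ <= b <= Num.max z _) xb (X0 w)).
  rewrite in_itv/= => /andP[c0 cr]; exists c; last by rewrite cb.
  by rewrite c0 (le_trans cr).
apply/seteqP; split=> w.
  move=> [r r0t Br]; have [xr|rx] := leP x (X r w).
    by left; exists r => //; exists (X r w) => //; rewrite xr lexx.
  by right; exists r => //; exists (X r w) => //; rewrite opprK lexx ltW.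
case=> -[r r0t [b Bb]].
  move=> /andP[xb br]; apply: (ivt w r b) => //.
  by rewrite ge_min xb le_max br orbT.
rewrite opprK => /andP[rb bx]; apply: (ivt w r b) => //.
by rewrite ge_min rb orbT le_max bx.
Qed.

End path_hits.

(** * Optional stopping along grids and the value at a hitting time *)

Section stopped_supermartingale.
Context {R : realType} {d : measure_display} {T : measurableType d}.
Variables (P : probability T R) (F : R -> set (set T)) (X : R -> T -> R) (x : R).
Hypotheses (filF : filtration F) (adX : adapted F X) (cX : continuous_paths X).
Hypotheses (X0 : forall w, X 0 w = x) (Xpos : forall t w, 0 <= t -> 0 < X t w).
Hypothesis smX : forall s t C, 0 <= s -> s <= t -> F s C ->
  (\int[P]_(w in C) (X t w)%:E <= \int[P]_(w in C) (X s w)%:E)%E.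

Let mX t : 0 <= t -> measurable_fun [set: T] (X t).
Proof.
by move=> t0 _ A mA; rewrite setTI; exact/(filtration_measurable filF t0)/adX.
Qed.

Let scX w : seq_continuous (X ^~ w).
Proof. exact/within_seq_continuous/cX. Qed.

Let mhit B t : 0 <= t -> measurable (hit X B t).
Proof.
move=> t0; apply: (filtration_measurable filF t0).
exact: (hit_adapted B filF adX cX X0).
Qed.

(** X at the first grid time by which B has been hit, capped at k * h. Hits are watched in
    continuous time, so none between grid points is missed and the delay is at most h. *)
Fixpoint stopped (B : set R) (h : R) (k : nat) (w : T) : R :=
  if k is k'.+1 then
    if w \in hit X B (k'%:R * h) then stopped B h k' w else X (k'.+1%:R * h) w
  else X 0 w.

Section discrete.
Variables (B : set R) (h : R).
Hypothesis h0 : 0 <= h.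

Let time0 (k : nat) : 0 <= k%:R * h. Proof. exact: mulr_ge0. Qed.

Let time_mono (k : nat) : k%:R * h <= k.+1%:R * h.
Proof. by rewrite ler_wpM2r// ler_nat. Qed.

Lemma stopped_not_hit k w : ~ hit X B (k%:R * h) w -> stopped B h k w = X (k%:R * h) w.
Proof.
case: k => [|k] nk /=; first by rewrite mul0r.
by rewrite memNset// => /(subset_hit (time_mono k)).
Qed.

Lemma stopped_gt0 k w : 0 < stopped B h k w.
Proof. by elim: k => [|k ih] /=; [exact: Xpos|case: ifP => // _; exact: Xpos]. Qed.

Lemma measurable_stopped k : measurable_fun [set: T] (stopped B h k).
Proof.
elim: k => [|k ih]; first exact: mX.
apply: measurable_fun_ifT => //; last exact: mX.
apply: (measurable_fun_bool true); rewrite setTI.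
rewrite (_ : _ @^-1` _ = hit X B (k%:R * h)); first exact: mhit.
by apply/seteqP; split=> w /=; [exact: set_mem|exact: mem_set].
Qed.

(** In one step the value is frozen on the event already hit; on its complement, known at time k *
    h, the supermartingale inequality applies. *)
Lemma stopped_expectation_le k : (\int[P]_w (stopped B h k w)%:E <= x%:E)%E.
Proof.
elim: k => [|k]; last apply: le_trans.
  under eq_integral do rewrite /= X0.
  by rewrite integral_cst//= probability_setT mule1.
set E := hit X B (k%:R * h).
have mE : measurable E by exact: mhit.
have split_int (f : T -> R) : (forall w, 0 < f w) -> measurable_fun [set: T] f ->
    (\int[P]_w (f w)%:E = \int[P]_(w in E) (f w)%:E + \int[P]_(w in ~` E) (f w)%:E)%E.
  move=> f0 mf; rewrite -ge0_integral_setU//.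
  - by rewrite setUv.
  - exact: measurableC.
  - by rewrite setUv; exact/measurable_EFinP.
  - by move=> w _; rewrite lee_fin ltW.
  - by apply/disj_setPS => w [].
rewrite (split_int _ (stopped_gt0 k.+1) (measurable_stopped k.+1)).
rewrite (split_int _ (stopped_gt0 k) (measurable_stopped k)).
apply: leeD.
  rewrite le_eqVlt; apply/orP; left; apply/eqP; apply: eq_integral => w wE /=.
  by rewrite -/E wE.
rewrite (eq_integral (fun w => (X (k.+1%:R * h) w)%:E)); last first.
  by move=> w; rewrite inE => nE /=; rewrite -/E memNset.
rewrite [leRHS](eq_integral (fun w => (X (k%:R * h) w)%:E)); last first.
  by move=> w; rewrite inE => nE; rewrite stopped_not_hit.
apply: smX => //.
have [_ sFC _] := filtration_sigma filF (time0 k).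
rewrite -setTD; apply: sFC; exact: (hit_adapted B filF adX cX X0).
Qed.

End discrete.

Section continuous_time.
Variable B : set R.
Hypothesis nBx : ~ B x.

(** Convertible with [hitting_time], but for a single process instead of the family indexed by
    starting points. *)
Definition first_hit (w : T) : \bar R :=
  ereal_inf [set t%:E | t in [set t : R | 0 < t /\ B (X t w)]].

Lemma first_hit_ge0 w : (0 <= first_hit w)%E.
Proof.
by apply: le_ereal_inf_tmp => _ [t [t0 _] <-]; rewrite lee_fin ltW.
Qed.

Lemma first_hit_le w (r t : R) : first_hit w = r%:E -> hit X B t w -> r <= t.
Proof.
move=> wr [v /andP[v0 vt] Bv]; apply: le_trans vt; rewrite -lee_fin -wr.
apply: ereal_inf_lbound; exists v => //; split=> //.
rewrite lt_neqAle v0 andbT; apply/eqP => v00.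
by apply: nBx; rewrite -(X0 w) v00.
Qed.

Lemma hit_first_hit w (t : R) : (first_hit w < t%:E)%E -> hit X B t w.
Proof.
move=> /ereal_inf_lt[_ [v [v0 Bv] <-]]; rewrite lte_fin => vt.
by exists v => //; rewrite !ltW.
Qed.

(** If the hit is detected in passing from k * h to (k + 1) * h, then r lies between these two
    times; afterwards q no longer changes. *)
Lemma stopped_near w (r h : R) k : 0 <= h -> first_hit w = r%:E ->
  exists q, [/\ 0 <= q, stopped B h k w = X q w,
    ~ hit X B (k%:R * h) w -> q = k%:R * h &
    hit X B (k%:R * h) w -> `|q - r| <= h].
Proof.
move=> h0 wr; elim: k => [|k [q [q0 qE nhq hq]]].
  exists 0; split=> //; first by rewrite mul0r.
  move=> [v]; rewrite mul0r -eq_le => /eqP <-; rewrite X0 => Bx.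
  by case: (nBx Bx).
have kk1 : k%:R * h <= k.+1%:R * h by rewrite ler_wpM2r// ler_nat.
have [hk|nhk] := pselect (hit X B (k%:R * h) w).
  exists q; split=> //=; first by rewrite mem_set.
  - by move=> nh; case: nh; exact: subset_hit hk.
  - by move=> _; exact: hq.
exists (k.+1%:R * h); split=> //; first by rewrite mulr_ge0.
  by rewrite /= memNset.
move=> hk1; have rk1 := first_hit_le wr hk1.
rewrite ger0_norm ?subr_ge0// lerBlDr -lerBlDl.
have -> : k.+1%:R * h - h = k%:R * h by rewrite -natr1; ring.
rewrite leNgt; apply/negP => rk; apply: nhk; apply: hit_first_hit.
by rewrite wr lte_fin.
Qed.

(** The mesh 1 / (n + 1) tends to 0 while the horizon, n * (n + 1) steps of it, is n. *)
Definition stopped_at_grid (n : nat) : T -> R := stopped B n.+1%:R^-1 (n * n.+1)%N.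

Lemma cvg_stopped_at_grid w (r : R) : first_hit w = r%:E ->
  stopped_at_grid n w @[n --> \oo] --> X r w.
Proof.
move=> wr.
have r0 : 0 <= r by rewrite -lee_fin -wr first_hit_ge0.
have /choice[q hq] : forall n, exists q, [/\ 0 <= q, `|q - r| <= n.+1%:R^-1 &
    r < n%:R -> stopped_at_grid n w = X q w].
  move=> n; have [rn|nr] := ltP r n%:R; last first.
    by exists r; split=> //; rewrite subrr normr0.
  have hn0 : 0 <= n.+1%:R^-1 :> R by [].
  have [q [q0 qE _ hq]] := stopped_near (n * n.+1) hn0 wr.
  exists q; split=> //; apply: hq.
  by rewrite natrM mulfK//; apply: hit_first_hit; rewrite wr lte_fin.
have qr : q @ \oo --> r.
  apply/cvgrPdist_le => e e0.
  have /cvgrPdist_le/(_ e e0) := @cvg_harmonic R.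
  apply: filterS => n; apply: le_trans; have [_ hqn _] := hq n.
  by rewrite sub0r normrN distrC /harmonic/= [leRHS]ger0_norm.
have q0 n : 0 <= q n by have [] := hq n.
have := @scX w _ _ r0 q0 qr; apply: cvg_trans; apply: near_eq_cvg.
near=> n; have [_ _ ->//] := hq n.
by near: n; exact: nbhs_infty_gtr.
Unshelve. all: by end_near. Qed.

(** [Y] is the liminf of the grid-stopped values: measurable by construction, bounded in mean by
    Fatou, and equal to the value at the hitting time by path continuity. Where B is never hit, only
    Y >= 0 is kept. *)
Theorem exists_hit_value : exists Y : T -> \bar R,
  [/\ measurable_fun [set: T] Y, (forall w, 0 <= Y w)%E,
     (\int[P]_w Y w <= x%:E)%E &
     forall w r, first_hit w = r%:E -> Y w = (X r w)%:E].
Proof.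
have h0 (n : nat) : 0 <= n.+1%:R^-1 :> R by [].
pose f n w := (stopped_at_grid n w)%:E.
have mf n : measurable_fun [set: T] (f n).
  by apply/measurable_EFinP; exact: measurable_stopped.
have f0 n w : (0 <= f n w)%E by rewrite lee_fin ltW// stopped_gt0.
exists (fun w => limn_einf (f ^~ w)); split.
- under eq_fun do rewrite /limn_einf /limf_einf.
  apply: measurableT_comp => //.
  apply: (measurable_fun_limn_esup (f := fun n w => - f n w)%E) => n.
  exact: measurableT_comp.
- move=> w; rewrite limn_einf_lim; apply: lime_ge; first exact: is_cvg_einfs.
  by apply: nearW => n; apply: le_ereal_inf_tmp => _ [k _ <-].
- apply: (@le_trans _ _ (limn_einf (fun n => \int[P]_w f n w))%E).
    exact: fatou.
  by apply: limn_einf_ub => n; exact: stopped_expectation_le.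
- move=> w r wr; apply: (cvg_limn_einf_sup _).1; apply: cvg_EFin.
    exact: nearW.
  exact: cvg_stopped_at_grid.
Qed.

End continuous_time.

End stopped_supermartingale.

(** * Bounds on the expected payoff *)

Section integral_upper_bound.
Context {R : realType} {d : measure_display} {T : measurableType d}.
Variable P : probability T R.
Local Open Scope ereal_scope.

(* The payoff f is not known to be measurable, but the integral of a
   nonnegative function is always a supremum over simple functions below it. *)
Lemma integral_le_majorant (f g : T -> \bar R) :
  (forall w, f w <= g w) -> (forall w, 0 <= g w) ->
  \int[P]_w f w <= \int[P]_w g w.
Proof.
move=> fg g0; rewrite [leLHS]integralE.
apply: (@le_trans _ _ (\int[P]_w f^\+ w)).
  rewrite -[leRHS]sube0; apply: leeB => //; exact: integral_ge0.
rewrite !ge0_integralTE//; apply: ereal_sup_le => _ [h hf <-].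
exists h => // w; apply: le_trans (hf w) _.
by rewrite funeposE ge_max fg g0.
Qed.

(** Raising g to +oo on the null set makes the bound hold everywhere and leaves the integral of g
    unchanged, without modifying f, which need not be measurable. *)
Lemma ae_integral_le_majorant (f g : T -> \bar R) :
  measurable_fun [set: T] g -> (forall w, 0 <= g w) ->
  {ae P, forall w, f w <= g w} -> \int[P]_w f w <= \int[P]_w g w.
Proof.
move=> mg g0 [N [mN PN fgN]].
pose g' w := if w \in N then +oo else g w.
have mN' : measurable_fun [set: T] (fun w => w \in N).
  apply: (measurable_fun_bool true); rewrite setTI (_ : _ @^-1` _ = N)//.
  by apply/seteqP; split=> w /=; [exact: set_mem|exact: mem_set].
have g'0 w : 0 <= g' w by rewrite /g'; case: ifP.
apply: (@le_trans _ _ (\int[P]_w g' w)).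
  apply: integral_le_majorant => // w; rewrite /g'; case: ifPn => [_|]; first exact: leey.
  by rewrite notin_setE => Nw; apply: contrapT => h; exact/Nw/fgN.
rewrite (ge0_ae_eq_integral _ _ mg)//; first exact: measurable_fun_ifT.
exists N; split=> // w /= h; apply: contrapT => Nw; apply: h => _.
by rewrite /g' memNset.
Qed.

End integral_upper_bound.

Section payoff_bounds.
Context {R : realType} {d : measure_display} {T : measurableType d}.
Variables (P : probability T R) (F : R -> set (set T)).
Variables (X : R -> R -> T -> R) (x beta : R).
Hypotheses (x0 : 0 < x) (beta0 : 0 < beta).
Hypotheses (filF : filtration F) (adX : adapted F (X x)).
Hypothesis cX : continuous_paths (X x).
Hypotheses (X0 : forall w, X x 0 w = x).
Hypothesis Xpos : forall t w, 0 <= t -> 0 < X x t w.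
Hypothesis smX : forall s t C, 0 <= s -> s <= t -> F s C ->
  (\int[P]_(w in C) (X x t w)%:E <= \int[P]_(w in C) (X x s w)%:E)%E.

Let scX w : seq_continuous (X x ^~ w).
Proof. exact/within_seq_continuous/cX. Qed.

Let mhit B t : 0 <= t -> measurable (hit (X x) B t).
Proof.
move=> t0; apply: (filtration_measurable filF t0).
exact: (hit_adapted B filF adX cX X0).
Qed.

(** Times of visits to B decrease to r and paths are continuous. A closed superset C is allowed so
    that B may be an open half-line. *)
Lemma first_hit_closed (B C : set R) w (r : R) : closed C -> B `<=` C ->
  first_hit (X x) B w = r%:E -> C (X x r w).
Proof.
move=> clC BC wr.
have r0 : 0 <= r by rewrite -lee_fin -wr first_hit_ge0.
have /choice[v hv] : forall n : nat, exists v, r <= v /\ v < r + n.+1%:R^-1 /\ 0 < v /\ B (X x v w).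
  move=> n.
  have : (first_hit (X x) B w < (r + n.+1%:R^-1)%:E)%E.
    by rewrite wr lte_fin ltrDl invr_gt0.
  move=> /ereal_inf_lt[_ [v [v0 Bv] <-]]; rewrite lte_fin => vr.
  exists v; split=> //; rewrite -lee_fin -wr; apply: ereal_inf_lbound.
  by exists v.
have vr : v @ \oo --> r.
  apply/cvgrPdist_le => e e0.
  have /cvgrPdist_le/(_ e e0) := @cvg_harmonic R.
  apply: filterS => n; apply: le_trans; have [rv [vrn _]] := hv n.
  rewrite sub0r normrN distrC /harmonic/= [leRHS]ger0_norm// ger0_norm ?subr_ge0//.
  by rewrite lerBlDl ltW.
have v0 n : 0 <= v n by have [_ [_ [/ltW]]] := hv n.
apply: (closed_cvg _ clC _ _ (@scX w _ _ r0 v0 vr)).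
by apply: nearW => n; apply: BC; have [_ [_ []]] := hv n.
Qed.

Let exceeds m := \bigcup_n hit (X x) `]m%:R, +oo[ n%:R.

Let mexceeds m : measurable (exceeds m).
Proof. by apply: bigcup_measurable => n _; exact: mhit. Qed.

(** On the event the hit value is at least m, while its expectation is at most x. *)
Lemma maximal_inequality (m : nat) : x <= m%:R ->
  (m%:R%:E * P (\bigcup_n hit (X x) `]m%:R, +oo[ n%:R) <= x%:E)%E.
Proof.
move=> xm.
have nx : ~ `]m%:R, +oo[%classic x by rewrite /= in_itv/= andbT ltNge xm.
have [Y [mY Y0 intY YE]] := exists_hit_value filF adX cX X0 Xpos smX nx.
apply: le_trans intY.
have -> : P (\bigcup_n hit (X x) `]m%:R, +oo[ n%:R) =
    (\int[P]_w (\1_(exceeds m) w)%:E)%E.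
  by rewrite integral_indic// setIT.
have m1 : measurable_fun [set: T] (fun w => (\1_(exceeds m) w)%:E : \bar R).
  by apply/measurable_EFinP; exact: measurable_indic.
rewrite -ge0_integralZl//.
apply: ge0_le_integral => //.
  exact: emeasurable_funM.
move=> w _; rewrite indicE; have [Ew|_] := boolP (w \in exceeds m); last by rewrite mule0.
rewrite mule1.
have [n _ hn] := set_mem Ew.
have fin : first_hit (X x) `]m%:R, +oo[ w \is a fin_num.
  rewrite ge0_fin_numE ?first_hit_ge0//.
  have [v /andP[v0 _] Bv] := hn.
  apply: (@le_lt_trans _ _ v%:E); last exact: ltry.
  apply: ereal_inf_lbound; exists v => //; split=> //.
  rewrite lt_neqAle v0 andbT; apply/eqP => v00.
  by apply: nx; rewrite -(X0 w) v00.
rewrite (YE w (fine (first_hit (X x) `]m%:R, +oo[ w))) ?fineK// lee_fin.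
have := @first_hit_closed `]m%:R, +oo[ `[m%:R, +oo[ w _ _ _ (esym (fineK fin)).
rewrite /= in_itv/= andbT; apply; first exact: rray_closed.
by move=> y; rewrite /= !in_itv/= !andbT => /ltW.
Qed.

(** An unbounded path exceeds every integer m, an event of probability at most x / m once m >= x. *)
Lemma ae_path_bounded :
  {ae P, forall w, exists M, forall r, 0 <= r -> X x r w <= M}.
Proof.
exists (\bigcap_m exceeds m); split.
- by apply: bigcap_measurableType => m _; exact: mexceeds.
- apply/eqP; rewrite eq_le measure_ge0 andbT; apply/lee_addgt0Pr => e e0.
  rewrite add0e.
  have [m [xm me]] : exists m : nat, x <= m%:R /\ x / e <= m%:R.
    have [m _ hm] := filterI (nbhs_infty_ger x) (nbhs_infty_ger (x / e)).
    by exists m; have [] := hm m (leqnn m).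
  have m0 : 0 < m%:R :> R by exact: lt_le_trans xm.
  apply: (@le_trans _ _ (P (exceeds m))).
    apply: le_measure; rewrite ?inE//.
      by apply: bigcap_measurableType => k _; exact: mexceeds.
    by move=> w; exact.
  rewrite -(@lee_pmul2l _ m%:R%:E)// ?lte_fin//.
  apply: le_trans (maximal_inequality xm) _.
  by rewrite -EFinM lee_fin -ler_pdivrMr.
- move=> w /= nbd m _; apply: contrapT => nE; apply: nbd; exists m%:R => r r0.
  rewrite leNgt; apply/negP => mr; apply: nE.
  exists (Num.truncn r).+1 => //; exists r; last by rewrite /= in_itv/= mr.
  by rewrite r0 ltW// truncnS_gt.
Qed.

Let delta (t : R) : R := 1 / (1 + beta * t).

Lemma discount_ge0 t : 0 <= t -> 0 <= delta t.
Proof. by move=> t0; rewrite divr_ge0// addr_ge0// mulr_ge0// ltW. Qed.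

Lemma discount_nincr s t : 0 <= s -> s <= t -> delta t <= delta s.
Proof.
move=> s0 st; have pos u : 0 <= u -> 0 < 1 + beta * u.
  by move=> u0; rewrite ltr_wpDr// mulr_ge0// ltW.
rewrite /delta !div1r lef_pV2 ?posrE ?pos ?(le_trans s0)//.
by rewrite lerD2l ler_pM2l.
Qed.

Lemma discount0 : delta 0 = 1.
Proof. by rewrite /delta mulr0 addr0 divr1. Qed.

Lemma limsup_discounted_le0 (g : R -> R) (M : R) :
  (forall r, 0 <= r -> 0 <= g r <= M) ->
  (limf_esup (fun t => (delta t * g t)%:E) (pinfty_nbhs R) <= 0)%E.
Proof.
move=> gM; apply/lee_addgt0Pr => e e0; rewrite add0e limf_esupE.
(* The threshold chosen next gives [delta t * M <= M / (beta * t) <= e] beyond it. *)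
have M0 : 0 <= M by have /andP[/le_trans] := gM 0 (lexx 0); exact.
pose V := [set t : R | M / (beta * e) < t].
apply: (@le_trans _ _ (ereal_sup ((fun t => (delta t * g t)%:E) @` V))).
  apply: ereal_inf_lbound; exists V => //; exists (M / (beta * e)).
  by split=> //; exact: num_real.
apply: ge_ereal_sup => _ [t Vt <-]; rewrite lee_fin.
have t0 : 0 < t.
  by apply: le_lt_trans Vt; rewrite divr_ge0// mulr_ge0// ltW.
have /andP[g0 gle] := gM t (ltW t0).
have pos : 0 < 1 + beta * t by rewrite addr_gt0// mulr_gt0.
rewrite /delta div1r mulrC ler_pdivrMr//.
move: Vt; rewrite /V/= ltr_pdivrMr ?mulr_gt0// => Mt.
by rewrite (le_trans gle)//; nra.
Qed.

Let payoff := stopped_payoff X (fun y => y) delta x.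

(** The factor c is quantified inside the almost-sure statement so that it may depend on the path: 1
    in general, smaller on paths that hit late. Without a hit, boundedness of the path makes the
    limsup at most 0. *)
Lemma payoff_le_hit_value (B : set R) (Y : T -> \bar R) :
  (forall w, 0 <= Y w)%E ->
  (forall w r, first_hit (X x) B w = r%:E -> Y w = (X x r w)%:E) ->
  {ae P, forall w, forall c, 0 <= c ->
    (forall r, 0 <= r -> first_hit (X x) B w = r%:E -> delta r <= c) ->
    (payoff B w <= c%:E * Y w)%E}.
Proof.
move=> Y0 YE; have [N [mN PN bdN]] := ae_path_bounded.
exists N; split=> // w /= h; apply: contrapT => Nw; apply: h => c c0.
have [M bM] : exists M, forall r, 0 <= r -> X x r w <= M.
  by apply: contrapT => h; exact/Nw/bdN.
rewrite /payoff /stopped_payoff.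
have fh0 := first_hit_ge0 (X x) B w.
case wr : (hitting_time X x B w) => [r| |] lec.
- have r0 : 0 <= r by rewrite -lee_fin -wr.
  rewrite (YE w r wr) -EFinM lee_fin ler_pM2r; last exact: Xpos.
  exact: lec.
- apply: (@le_trans _ _ 0%E); last by rewrite mule_ge0.
  apply: (@limsup_discounted_le0 (X x ^~ w) M) => v v0.
  by apply/andP; split; [exact/ltW/Xpos|exact: bM].
- by have : (0 <= hitting_time X x B w)%E := fh0; rewrite wr.
Qed.

Lemma payoff_le_value (B : set R) (Y : T -> \bar R) :
  (forall w, 0 <= Y w)%E ->
  (forall w r, first_hit (X x) B w = r%:E -> Y w = (X x r w)%:E) ->
  {ae P, forall w, (payoff B w <= Y w)%E}.
Proof.
move=> Y0 YE; have [N [mN PN hN]] := payoff_le_hit_value Y0 YE.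
exists N; split=> // w h; apply: hN => k; apply: h; rewrite /= -[leRHS]mul1e.
by apply: k => // r r0 _; rewrite -discount0; exact: discount_nincr.
Qed.

Lemma J_le_start (B : set R) : ~ B x -> (J P X (fun y => y) delta x B <= x%:E)%E.
Proof.
move=> nBx.
have [Y [mY Y0 intY YE]] := exists_hit_value filF adX cX X0 Xpos smX nBx.
apply: le_trans intY; apply: ae_integral_le_majorant => //.
exact: payoff_le_value.
Qed.

(** On the event [G n] of no hit up to time 1 / (n + 1), the discount is at most a constant c < 1,
    and these events exhaust the sample space. *)
Lemma J_lt_start (B : set R) : ~ B x -> closed_rel `]0, +oo[ B ->
  (J P X (fun y => y) delta x B < x%:E)%E.
Proof.
move=> nBx [C clC BE].
have [Y [mY Y0 intY YE]] := exists_hit_value filF adX cX X0 Xpos smX nBx.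
have nCx : ~ C x by move=> Cx; apply: nBx; rewrite BE /= in_itv/= x0.
pose G (n : nat) := ~` hit (X x) B n.+1%:R^-1.
have mG n : measurable (G n) by apply/measurableC/mhit.
(* A path outside every [G n] visits B at times tending to 0, so x would lie in the closed set C. *)
have GT : \bigcup_n G n = setT.
  apply/seteqP; split=> // w _; apply: contrapT => nG.
  have /choice[v hv] : forall n : nat, exists v, 0 <= v <= n.+1%:R^-1 /\ B (X x v w).
    move=> n; apply: contrapT => nv; apply: nG; exists n => // -[v v1 Bv].
    by apply: nv; exists v.
  have v0 n : 0 <= v n by have [/andP[]] := hv n.
  have cv : v @ \oo --> (0 : R).
    apply/cvgrPdist_le => e e0.
    have /cvgrPdist_le/(_ e e0) := @cvg_harmonic R.
    apply: filterS => n; apply: le_trans; have [/andP[vn0 vn] _] := hv n.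
    by rewrite !sub0r !normrN /harmonic/= !ger0_norm.
  apply: nCx; rewrite -(X0 w).
  apply: (closed_cvg _ clC _ _ (@scX w _ _ (lexx 0) v0 cv)).
  by apply: nearW => n; have [_] := hv n; rewrite BE => -[].
have ndG : nondecreasing_seq G.
  move=> m n mn; apply/subsetPset => w nh; apply: contra_not nh.
  apply: subset_hit; rewrite lef_pV2 ?posrE ?ltr0Sn// ler_nat//.
(* If Y has no mass on any [G n], monotone convergence makes its integral 0, already below x;
   otherwise the factor c gains strictly on some [G n]. *)
have [[n pn]|np] := pselect (exists n, (0 < \int[P]_(w in G n) Y w)%E); last first.
  have intY0 : (\int[P]_w Y w = 0)%E.
    have := @ge0_nondecreasing_set_cvg_integral _ _ _ G Y P ndG mG
      (fun n => measurable_funTS mY) (fun n w _ => Y0 w).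
    rewrite GT => /cvg_lim <- //; apply: lim_near_cst => //; apply: nearW => n.
    apply/eqP; rewrite eq_le integral_ge0// andbT leNgt; apply/negP => pn.
    by apply: np; exists n.
  apply: (@le_lt_trans _ _ (\int[P]_w Y w)%E); last by rewrite intY0 lte_fin.
  by apply: ae_integral_le_majorant => //; exact: payoff_le_value.
have n1 : 0 < n.+1%:R^-1 :> R by [].
pose c := delta n.+1%:R^-1.
have c0 : 0 <= c by apply: discount_ge0.
have c1 : c < 1.
  by rewrite /c /delta div1r invf_lt1 ?ltrDl ?mulr_gt0// addr_gt0// mulr_gt0.
pose g w := if w \in G n then (c%:E * Y w)%E else Y w.
have mg : measurable_fun [set: T] g.
  apply: measurable_fun_ifT => //; last exact: emeasurable_funM.
  apply: (measurable_fun_bool true); rewrite setTI (_ : _ @^-1` _ = G n)//.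
  by apply/seteqP; split=> w /=; [exact: set_mem|exact: mem_set].
have g0 w : (0 <= g w)%E by rewrite /g; case: ifP => _ //; rewrite mule_ge0.
have Jg : (J P X (fun y => y) delta x B <= \int[P]_w g w)%E.
  apply: ae_integral_le_majorant => //.
  have [N [mN PN hN]] := payoff_le_hit_value Y0 YE.
  exists N; split=> // w h; apply: hN => k; apply: h; rewrite /= /g.
  case: ifPn => [/set_mem Gw|_].
    apply: k => // r r0 wr; apply: discount_nincr; first exact: ltW.
    rewrite leNgt; apply/negP => rn; apply: Gw; apply: hit_first_hit.
    by rewrite wr lte_fin.
  rewrite -[leRHS]mul1e; apply: k => // r r0 _.
  by rewrite -discount0; exact: discount_nincr.
apply: le_lt_trans Jg _; apply: (lt_le_trans _ intY).
have split_int (f : T -> \bar R) : (forall w, 0 <= f w)%E ->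
    measurable_fun [set: T] f ->
    (\int[P]_w f w = \int[P]_(w in G n) f w + \int[P]_(w in ~` G n) f w)%E.
  move=> f0 mf; rewrite -ge0_integral_setU//.
  - by rewrite setUv.
  - exact: measurableC.
  - by rewrite setUv.
  - by apply/disj_setPS => w [].
rewrite (split_int Y)// (split_int g)//.
have pfin : (\int[P]_(w in G n) Y w)%E \is a fin_num.
  rewrite ge0_fin_numE ?integral_ge0//; apply: le_lt_trans (ltry x).
  apply: le_trans intY; rewrite (split_int Y)// leeDl// integral_ge0//.
have -> : (\int[P]_(w in G n) g w = \int[P]_(w in G n) (c%:E * Y w))%E.
  by apply: eq_integral => w Gw; rewrite /g Gw.
have -> : (\int[P]_(w in ~` G n) g w = \int[P]_(w in ~` G n) Y w)%E.
  by apply: eq_integral => w; rewrite inE => nGw; rewrite /g memNset.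
rewrite ge0_integralZl//; last exact: measurable_funTS.
rewrite lteD2rE//; last first.
  rewrite ge0_fin_numE ?integral_ge0//; apply: le_lt_trans (ltry x).
  apply: le_trans intY; rewrite (split_int Y)// leeDr// integral_ge0//.
by rewrite -(fineK pfin) -EFinM lte_fin gtr_pMl// -lte_fin fineK.
Qed.

End payoff_bounds.

(** * The half-line as an equilibrium, and the conclusion *)

Lemma J_half_line (R : realType) (d : measure_display) (T : measurableType d)
    (P : probability T R) (X : R -> R -> T -> R) (f delta : R -> R) (x : R) :
  delta 0 = 1 -> (forall w, X x 0 w = x) ->
  (forall t w, 0 <= t -> 0 < X x t w) ->
  J P X f delta x `]0, +oo[ = (f x)%:E.
Proof.
move=> delta0 X0 Xpos.
(* Every positive time is a visit, so the infimum is 0 although time 0 itself is excluded. *)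
have hit0 w : hitting_time X x `]0, +oo[ w = 0%E.
  apply/eqP; rewrite eq_le first_hit_ge0 andbT; apply/lee_addgt0Pr => e e0.
  rewrite add0e; apply: ereal_inf_lbound; exists e => //; split=> //.
  by rewrite /= in_itv/= andbT; exact/Xpos/ltW.
rewrite /J (_ : (fun w => _) = cst (f x)%:E).
  by rewrite integral_cst//= probability_setT mule1.
by apply/funext => w; rewrite /stopped_payoff hit0 /= delta0 mul1r X0.
Qed.

Theorem proposition6p3 (R : realType) (d : measure_display)
    (T : measurableType d) (P : probability T R) (F : R -> set (set T))
    (W : R -> T -> R) (X : R -> R -> T -> R) (mu sigma beta : R) :
  0 < sigma -> 0 < beta ->
  brownian_motion P F W ->
  geometric_brownian_motion P F W mu sigma X ->
  let nu := mu / sigma ^+ 2 - 1 / 2 in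
  nu <= - (1 / 2) ->
  let D : set R := `]0, +oo[%classic in
  let f := fun x : R => x in
  let delta := fun t : R => 1 / (1 + beta * t) in
  [/\ forall A : set R, closed_equilibrium P D X f delta A <-> A = D,
      Rstar P D X f delta = D &
      forall A : set R,
        optimal_equilibrium P D X f delta A /\ closed_rel D A <-> A = D].
Proof.
move=> sigma0 beta0 BM GBM nu nu_le D f delta.
(* The bound on nu says exactly that mu / sigma^2 <= 0. *)
have mu0 : mu <= 0.
  have : mu / sigma ^+ 2 <= 0 by move: nu_le; rewrite /nu lerBlDr addNr.
  by rewrite pmulr_lle0// invr_gt0 exprn_gt0.
have filF := brownian_filtration BM.
have adX x : 0 < x -> adapted F (X x) by move=> /GBM[[]].
have cX x : 0 < x -> continuous_paths (X x) by move=> /GBM[[]].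
have X0 x : 0 < x -> forall w, X x 0 w = x by move=> /GBM[[]].
have Xpos x : 0 < x -> forall t w, 0 <= t -> 0 < X x t w by move=> /GBM[].
have smX x : 0 < x -> forall s t C, 0 <= s -> s <= t -> F s C ->
    (\int[P]_(w in C) (X x t w)%:E <= \int[P]_(w in C) (X x s w)%:E)%E.
  move=> x0 s t C s0 st; have [sol pos] := GBM x x0.
  exact: (diffusion_supermartingale BM mu0 sol pos s0 st).
have DE x : D x = (0 < x) :> Prop by rewrite /D /= in_itv/= andbT.
have JD x : 0 < x -> J P X f delta x D = x%:E.
  move=> x0; apply: (J_half_line _ f) => //.
  - by rewrite /delta mulr0 addr0 divr1.
  - exact: X0.
  - exact: Xpos.
have J_lt x A : 0 < x -> ~ A x -> closed_rel D A -> (J P X f delta x A < x%:E)%E.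
  move=> x0 nAx clA.
  exact: (J_lt_start x0 beta0 filF (adX x x0) (@cX x x0) (X0 x x0) (Xpos x x0) (smX x x0)).
have J_le x A : 0 < x -> ~ A x -> (J P X f delta x A <= x%:E)%E.
  move=> x0 nAx.
  exact: (J_le_start x0 beta0 filF (adX x x0) (@cX x x0) (X0 x x0) (Xpos x x0) (smX x x0)).
(* Every point is indifferent for [D], since stopping at once and [J] both give x; [Theta] keeps all
   of them because they already belong to [D]. *)
have eqD : equilibrium P D X f delta D.
  split; [exact: measurable_itv|by []|].
  apply/seteqP; split=> [x [[]//|[]//]|x Dx]; right; split=> //.
  by split=> //; rewrite JD// -DE.
have clD : closed_rel D D by exists setT; rewrite ?setIT//; exact: closedT.
have ceqE A : closed_equilibrium P D X f delta A <-> A = D.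
  split=> [[[mA AD ThA] clA]|->]; last by split.
  apply/seteqP; split=> // x Dx; apply: contrapT => nAx; apply: (nAx).
  by rewrite -ThA; left; split=> //; apply: J_lt => //; rewrite -DE.
split; first exact: ceqE.
  apply/seteqP; split=> [x|x Dx A /ceqE ->//].
  by apply; exact/ceqE.
move=> A; split=> [[[eqA _] clA]|->]; first by apply/ceqE.
split=> //; split=> // x B Dx [mB BD ThB].
have x0 : 0 < x by rewrite -DE.
rewrite /V JD// maxxx ge_max lexx/=.
have [|nBx] := pselect (B x); last exact: J_le.
by rewrite -{1}ThB => -[[_ /ltW]|[[_ <-] _]].
Qed.
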